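(* Let $\mathcal{F}=(\mu_n,\mathcal{S}_n,K_n,\pi_n)_{n\ge1}$ be a family of irreducible, reversible discrete-time finite Markov chains with $\pi_n(|\mu_n/\pi_n|^2)\to\infty$. Let $\mathcal{F}_c$ be the family of associated continuous-time chains and, for $\theta\in(0,1)$, $\mathcal{F}_\theta$ the family of $\theta$-lazy chains, with $L^2$-mixing times $T^{(c)}_{n,2}(\mu_n,\cdot)$ and $T^{(\theta)}_{n,2}(\mu_n,\cdot)$. (1) If $\theta\in[1/2,1)$, $\mathcal{F}_\theta$ has an $L^2$-cutoff and $T^{(\theta)}_{n,2}(\mu_n,\epsilon_0)\to\infty$ for some $\epsilon_0>0$, then $\mathcal{F}_c$ has an $L^2$-cutoff. (2) If $\mathcal{F}_c$ has an $L^2$-cutoff and $T^{(c)}_{n,2}(\mu_n,\epsilon_0)\to\infty$ for some $\epsilon_0>0$, then $\mathcal{F}_\theta$ has an $L^2$-cutoff for all $\theta\in(1/2,1)$. Moreover, for $\theta\in(1/2,1)$, if both $\mathcal{F}_c$ and $\mathcal{F}_\theta$ have $L^2$-cutoffs and there is $\epsilon_0>0$ with $T^{(c)}_{n,2}(\mu_n,\epsilon_0)\to\infty$ or $T^{(\theta)}_{n,2}(\mu_n,\epsilon_0)\to\infty$, then for all $\epsilon>0$ \[1-\theta\le\liminf_n\frac{T^{(c)}_{n,2}(\mu_n,\epsilon)}{T^{(\theta)}_{n,2}(\mu_n,\epsilon)}\le\limsup_n\frac{T^{(c)}_{n,2}(\mu_n,\epsilon)}{T^{(\theta)}_{n,2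}(\mu_n,\epsilon)}\le\frac{-\log(2\theta-1)}{2}.\]
   Context: For a discrete-time chain $(\mathcal{S},K,\pi)$ and $\theta\in(0,1)$, its $\theta$-lazy version is the discrete-time chain with transition matrix $K_\theta=\theta I+(1-\theta)K$, and its associated continuous-time chain has generator $L=K-I$; both keep initial distribution $\mu_n$ and stationary distribution $\pi_n$. $L^2$-distance: continuous time $d_2(\mu,t)=\|\mu e^{tL}/\pi-1\|_{L^2(\pi)}$, discrete time $d_2(\mu,m)=\|\mu K^m/\pi-1\|_{L^2(\pi)}$; mixing time $T_2(\mu,\epsilon)=\min\{t\ge0:d_2(\mu,t)\le\epsilon\}$ (integer $t$ in discrete time); $\pi(|\mu/\pi|^2)=\sum_y\mu(y)^2/\pi(y)$. $L^2$-cutoff: there is $t_n>0$ with $d_{n,2}(\mu_n,(1+a)t_n)\to0$ and $d_{n,2}(\mu_n,(1-a)t_n)\to\infty$ for all $a\in(0,1)$ (in discrete time, with times $\lceil(1+a)t_n\rceil$ and $\lfloor(1-a)t_n\rfloor$). *)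

(* Defs.v *)
From Stdlib Require Import Reals Lra Lia ZArith Arith List ClassicalEpsilon.
Open Scope R_scope.

(* State space S_n = {0, ..., N-1}; kernels/measures are functions on nat,
   only their values on {0..N-1} matter. *)

Definition fsum (N : nat) (f : nat -> R) : R :=
  fold_right Rplus 0 (map f (seq 0 N)).

Definition delta (x y : nat) : R := if Nat.eqb x y then 1 else 0.

Fixpoint matpow (N : nat) (K : nat -> nat -> R) (m : nat) : nat -> nat -> R :=
  match m with
  | O => delta
  | S m' => fun x y => fsum N (fun z => matpow N K m' x z * K z y)
  end.

Definition is_chain (N : nat) (K : nat -> nat -> R) (pi : nat -> R) : Prop :=
  (0 < N)%nat /\
  (forall x y, (x < N)%nat -> (y < N)%nat -> 0 <= K x y) /\
  (forall x, (x < N)%nat -> fsum N (K x) = 1) /\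
  (forall x, (x < N)%nat -> 0 < pi x) /\
  fsum N pi = 1.

Definition reversible (N : nat) (K : nat -> nat -> R) (pi : nat -> R) : Prop :=
  forall x y, (x < N)%nat -> (y < N)%nat -> pi x * K x y = pi y * K y x.

Definition irreducible (N : nat) (K : nat -> nat -> R) : Prop :=
  forall x y, (x < N)%nat -> (y < N)%nat -> exists m, 0 < matpow N K m x y.

Definition is_prob (N : nat) (mu : nat -> R) : Prop :=
  (forall x, (x < N)%nat -> 0 <= mu x) /\ fsum N mu = 1.

Definition distr (N : nat) (mu : nat -> R) (K : nat -> nat -> R) (m : nat)
  : nat -> R := fun y => fsum N (fun x => mu x * matpow N K m x y).

Definition l2dist (N : nat) (pi nu : nat -> R) : R :=
  sqrt (fsum N (fun y => pi y * (nu y / pi y - 1) ^ 2)).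

(* pi(|mu/pi|^2) *)
Definition chi2 (N : nat) (pi mu : nat -> R) : R :=
  fsum N (fun y => mu y ^ 2 / pi y).

Definition series_val (u : nat -> R) : R :=
  epsilon (inhabits 0) (fun l => infinite_sum u l).

(* mu e^{tL}, L = K - I:  e^{tL} = e^{-t} sum_k t^k K^k / k! *)
Definition heat (N : nat) (K : nat -> nat -> R) (mu : nat -> R) (t : R)
  : nat -> R :=
  fun y => exp (- t) * series_val (fun k => t ^ k / INR (fact k) * distr N mu K k y).

Definition d2_disc (N : nat) (K : nat -> nat -> R) (pi mu : nat -> R) (m : nat) : R :=
  l2dist N pi (distr N mu K m).

Definition d2_cont (N : nat) (K : nat -> nat -> R) (pi mu : nat -> R) (t : R) : R :=
  l2dist N pi (heat N K mu t).

Definition lazyK (theta : R) (K : nat -> nat -> R) : nat -> nat -> R :=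
  fun x y => theta * delta x y + (1 - theta) * K x y.

Definition T2_cont (d : R -> R) (eps : R) : R :=
  epsilon (inhabits 0)
    (fun t => 0 <= t /\ d t <= eps /\ forall s, 0 <= s -> d s <= eps -> t <= s).

Definition T2_disc (d : nat -> R) (eps : R) : nat :=
  epsilon (inhabits 0%nat)
    (fun m => d m <= eps /\ forall m', d m' <= eps -> (m <= m')%nat).

Definition nat_floor (x : R) : nat := Z.to_nat (Int_part x).
Definition nat_ceil (x : R) : nat := Z.to_nat (- Int_part (- x)).

Definition cutoff_cont (d : nat -> R -> R) : Prop :=
  exists tn : nat -> R, (forall n, 0 < tn n) /\
    forall a, 0 < a < 1 ->
      Un_cv (fun n => d n ((1 + a) * tn n)) 0 /\
      cv_infty (fun n => d n ((1 - a) * tn n)).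

Definition cutoff_disc (d : nat -> nat -> R) : Prop :=
  exists tn : nat -> R, (forall n, 0 < tn n) /\
    forall a, 0 < a < 1 ->
      Un_cv (fun n => d n (nat_ceil ((1 + a) * tn n))) 0 /\
      cv_infty (fun n => d n (nat_floor ((1 - a) * tn n))).

(* Main.v *)
(** By reversibility the squared L2-distances are integrals against one positive measure on the
    eigenvalues [l] of [I - K]: F(t) = sum w exp(-2tl) in continuous time and
    G(m) = sum w (1 - (1 - theta) l)^(2m) for the lazy chain.  Since [l] lies in [0, 2],
    exp(-c l) <= 1 - (1 - theta) l <= exp(-(1 - theta) l) with c = -ln(2 theta - 1)/2 (the lower
    bound for theta > 1/2), so that F(c m) <= G(m) <= F((1 - theta) m); this gives the comparison
    of mixing times.

    A cutoff at times t_n forces the spectral mass of [0, L/t_n] to vanish for every L.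
    Conversely, if this holds along the mixing times r_n at level 1, then apart from a negligible
    mass the energy decays at rate at least L/r_n with L arbitrary, so it jumps from infinity to 0
    around r_n.  The condition is insensitive to changing the times by bounded factors, so the
    comparison of mixing times transfers it between the two families. *)

Require Import Defs.
From Stdlib Require Import Reals Lra Lia Arith ZArith List.
From Stdlib Require Import ClassicalChoice ClassicalEpsilon FunctionalExtensionality.
From mathcomp Require all_boot all_order all_algebra complex Rstruct.
Open Scope R_scope.

(** * Spectral theorem for symmetric matrices *)

Module SymmetricMoments.
Import all_boot all_order all_algebra complex Rstruct.
Import GRing.Theory Num.Theory.
Local Open Scope ring_scope.
Local Open Scope sesquilinear_scope.

(** The matrix is diagonalised over [F[i]], where the spectral theorem for hermitian matrices
    applies: A = P^* D P with P unitary. With v = c P this gives v A^k v^T = sum |c_i|^2 D_i^k.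
    Weights and eigenvalues are real, so their real parts bring the identity back to [F]. *)
Lemma symmetric_moments (F : rcfType) n (A : 'M[F]_n) (v : 'rV[F]_n) :
  A^T = A ->
  exists w b : 'I_n -> F, (forall i, 0 <= w i) /\
    forall k, (iter k (mulmx^~ A) v *m v^T) 0 0 = \sum_i w i * b i ^+ k.
Proof.
move=> symA.
pose C : numClosedFieldType := F[i]%C.
pose f : {rmorphism F -> C} := real_complex F.
have realf m p (M : 'M[F]_(m, p)) : map_mx f M \is a mxOver Num.real.
  by apply/mxOverP => i j; rewrite mxE; apply/complex_realP; exists (M i j).
pose Ac := map_mx f A.
have hA : Ac \is hermsymmx.
  apply: realsym_hermsym; last exact: realf.
  by apply/is_hermitianmxP; rewrite /= map_mx_id // expr0 scale1r /Ac map_trmx symA.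
have /orthomx_spectralP := hermitian_normalmx hA.
have := hermitian_spectral_diag_real hA.
have uP := spectral_unitarymx Ac.
rewrite (invmx_unitary uP).
set P := spectralmx Ac in uP *; set D := spectral_diag Ac => /mxOverP realD eA.
pose vc := map_mx f v; pose c := vc *m P^t*.
have fRe x : x \is Num.real -> f (complex.Re x) = x by apply: RRe_real.
have cge0 i : 0 <= c 0 i * (c 0 i)^* by apply: mul_conjC_ge0.
exists (fun i => complex.Re (c 0 i * (c 0 i)^*)), (fun i => complex.Re (D 0 i)); split.
  by move=> i; rewrite -ler0c -[_%:C%C]/(f _) fRe ?ger0_real.
move=> k.
apply: (@fmorph_inj _ _ f).
rewrite rmorph_sum /=.
transitivity ((map_mx f (iter k (mulmx^~ A) v *m v^T)) 0 0); first by rewrite [RHS]mxE.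
have iterE : map_mx f (iter k (mulmx^~ A) v) = (\row_i (c 0 i * D 0 i ^+ k)) *m P.
  elim: k => [|k IHk] /=.
    have -> : \row_i (c 0 i * D 0 i ^+ 0) = c.
      by apply/rowP => i; rewrite mxE expr0 mulr1.
    by rewrite /c mulmxKtV.
  rewrite map_mxM IHk -/Ac eA !mulmxA mulmxtVK //; congr (_ *m _).
  by rewrite mul_mx_diag; apply/rowP => i; rewrite !mxE exprSr mulrA.
(* Conjugation fixes [vc], because its entries come from [F]. *)
have conjv : P *m vc^T = c^t*.
  rewrite /c trmx_mul map_mxM /= trmxCK; congr (_ *m _).
  by apply/matrixP => i j; rewrite !mxE; apply/esym/CrealP/complex_realP; exists (v j i).
rewrite map_mxM iterE -map_trmx -/vc -mulmxA conjv mxE; apply: eq_bigr => i _.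
rewrite rmorphM rmorphXn /= -![real_complex F _]/(f _).
by rewrite (fRe _ (realD 0 i)) (fRe _ (ger0_real (cge0 i))) !mxE mulrAC.
Qed.

Lemma fsum_bigop N (g : nat -> R) : fsum N g = \sum_(i < N) g i.
Proof.
rewrite -(big_mkord xpredT g) /fsum /index_iota subn0.
have -> m n : List.seq m n = iota m n by elim: n m => //= n IHn m; rewrite IHn.
by elim: (iota 0 N) => [|x s IHs]; rewrite ?big_nil ?big_cons //= IHs.
Qed.

(** Bridge from matrices to functions on [nat]. The iterates enter through their recursion, so any
    sequence satisfying it below [N] can be supplied. *)
Lemma self_adjoint_moments N (A : nat -> nat -> R) (v : nat -> nat -> R) :
  (forall x y, (x < N)%coq_nat -> (y < N)%coq_nat -> A x y = A y x) ->
  (forall k y, (y < N)%coq_nat -> v (S k) y = fsum N (fun x => Rmult (v k x) (A x y))) ->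
  exists w b : nat -> R, (forall i, (i < N)%coq_nat -> Rle R0 (w i)) /\
    forall k, fsum N (fun y => Rmult (v k y) (v 0%nat y)) =
      fsum N (fun i => Rmult (w i) (pow (b i) k)).
Proof.
move=> symA vS.
pose M : 'M[R]_N := \matrix_(x, y) A x y.
have symM : M^T = M.
  by apply/matrixP => x y; rewrite !mxE; apply: symA; apply/ltP.
have [w [b [w0 wb]]] := symmetric_moments _ _ _ (\row_y v 0%nat y) symM.
(* Indices outside the state space get the default value 0. *)
pose ext (g : 'I_N -> R) (n : nat) : R := oapp g 0 (insub n).
have extE g (i : 'I_N) : ext g i = g i by rewrite /ext valK.
exists (ext w), (ext b); split => [i /ltP lt_i | k].
  by apply/RleP; rewrite (extE w (Ordinal lt_i)).
rewrite !fsum_bigop.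
have vE : iter k (mulmx^~ M) (\row_y v 0%nat y) = \row_y v k y.
  elim: k => [|k IHk] //=; rewrite IHk; apply/rowP => y.
  rewrite !mxE vS ?fsum_bigop; last exact/ltP.
  by apply: eq_bigr => x _; rewrite !mxE.
transitivity (\sum_i w i * b i ^+ k).
  by rewrite -wb vE mxE; apply: eq_bigr => y _; rewrite !mxE.
by apply: eq_bigr => i _; rewrite !extE RpowE.
Qed.
End SymmetricMoments.

(** * Spectral representation of the L2-distances *)

Lemma fsum_S N f : fsum (S N) f = fsum N f + f N.
Proof.
  unfold fsum. rewrite seq_S, map_app, fold_right_app. simpl.
  induction (seq 0 N) as [|x s IH]; simpl; lra.
Qed.

Lemma fsum_ext N f g : (forall i, (i < N)%nat -> f i = g i) -> fsum N f = fsum N g.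
Proof.
  induction N as [|N IH]; intros H; [reflexivity|].
  rewrite !fsum_S, IH, H; auto.
Qed.

Lemma fsum_le N f g : (forall i, (i < N)%nat -> f i <= g i) -> fsum N f <= fsum N g.
Proof.
  induction N as [|N IH]; intros H; [apply Rle_refl|].
  rewrite !fsum_S. apply Rplus_le_compat; auto.
Qed.

Lemma fsum_linear N a c f g :
  fsum N (fun i => a * f i + c * g i) = a * fsum N f + c * fsum N g.
Proof.
  induction N as [|N IH]; [unfold fsum; simpl; ring|].
  rewrite !fsum_S, IH. ring.
Qed.

Lemma fsum_scal N a f : fsum N (fun i => a * f i) = a * fsum N f.
Proof.
  rewrite <- (Rplus_0_r (a * fsum N f)), <- (Rmult_0_l (fsum N f)), <- fsum_linear.
  apply fsum_ext. intros. ring.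
Qed.

Lemma fsum_minus N f g : fsum N (fun i => f i - g i) = fsum N f - fsum N g.
Proof.
  transitivity (1 * fsum N f + (-1) * fsum N g); [|ring].
  rewrite <- fsum_linear. apply fsum_ext. intros. ring.
Qed.

Lemma fsum_nonneg N f : (forall i, (i < N)%nat -> 0 <= f i) -> 0 <= fsum N f.
Proof.
  intros H. rewrite <- (Rmult_0_l (fsum N f)), <- fsum_scal.
  apply fsum_le. intros i Hi. rewrite Rmult_0_l. auto.
Qed.

Lemma fsum_ge_term N f i :
  (forall j, (j < N)%nat -> 0 <= f j) -> (i < N)%nat -> f i <= fsum N f.
Proof.
  intros H Hi. induction N as [|N IH]; [lia|].
  rewrite fsum_S. destruct (Nat.eq_dec i N) as [->|Hne].
  - assert (0 <= fsum N f) by (apply fsum_nonneg; auto). lra.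
  - assert (f i <= fsum N f) by (apply IH; auto; lia).
    assert (0 <= f N) by auto. lra.
Qed.

Lemma fsum_swap N M f :
  fsum N (fun i => fsum M (fun j => f i j)) = fsum M (fun j => fsum N (fun i => f i j)).
Proof.
  induction N as [|N IH].
  - symmetry. transitivity (fsum M (fun _ => 0 * 0)); [|rewrite fsum_scal; apply Rmult_0_l].
    apply fsum_ext. intros. rewrite Rmult_0_l. reflexivity.
  - rewrite fsum_S, IH.
    transitivity (1 * fsum M (fun j => fsum N (fun i => f i j)) + 1 * fsum M (fun j => f N j)); [ring|].
    rewrite <- fsum_linear. apply fsum_ext. intros. rewrite fsum_S. ring.
Qed.

Lemma fsum_delta N f y : (y < N)%nat -> fsum N (fun x => f x * delta x y) = f y.
Proof.
  assert (Hnot : forall M, (M <= y)%nat -> fsum M (fun x => f x * delta x y) = 0).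
  { induction M as [|M IH]; intros HM; [reflexivity|].
    rewrite fsum_S, IH by lia. unfold delta.
    destruct (Nat.eqb_spec M y); [lia|ring]. }
  induction N as [|N IH]; intros Hy; [lia|].
  rewrite fsum_S. destruct (Nat.eq_dec y N) as [->|Hne].
  - rewrite Hnot by lia. unfold delta. rewrite Nat.eqb_refl. ring.
  - rewrite IH by lia. unfold delta. destruct (Nat.eqb_spec N y); [lia|ring].
Qed.

Lemma Un_cv_const c : Un_cv (fun _ => c) c.
Proof. intros e He. exists 0%nat. intros. rewrite Rdist_eq. exact He. Qed.

Lemma fsum_cv N (u : nat -> nat -> R) l :
  (forall i, (i < N)%nat -> Un_cv (fun M => u M i) (l i)) ->
  Un_cv (fun M => fsum N (u M)) (fsum N l).
Proof.
  induction N as [|N IH]; intros H.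
  - exact (Un_cv_const 0).
  - rewrite fsum_S.
    apply Un_cv_ext with (fun M => fsum N (u M) + u M N).
    + intros. symmetry. apply fsum_S.
    + apply CV_plus; auto.
Qed.

(** * Deviation from stationarity and its moments *)

Lemma distr_0 N mu K y : (y < N)%nat -> distr N mu K 0 y = mu y.
Proof. exact (fsum_delta N mu y). Qed.

Lemma distr_S N mu K k y :
  distr N mu K (S k) y = fsum N (fun x => distr N mu K k x * K x y).
Proof.
  unfold distr. simpl.
  transitivity (fsum N (fun x => fsum N (fun z => mu x * (matpow N K k x z * K z y)))).
  { apply fsum_ext. intros. rewrite fsum_scal. reflexivity. }
  rewrite fsum_swap. apply fsum_ext. intros z _.
  rewrite (Rmult_comm _ (K z y)), <- fsum_scal. apply fsum_ext. intros. ring.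
Qed.

Section Chain.
Context (N : nat) (K : nat -> nat -> R) (pi mu : nat -> R).
Context (Hchain : is_chain N K pi) (Hrev : reversible N K pi) (Hmu : is_prob N mu).

Let K_nonneg : forall x y, (x < N)%nat -> (y < N)%nat -> 0 <= K x y := proj1 (proj2 Hchain).
Let K_sum : forall x, (x < N)%nat -> fsum N (K x) = 1 := proj1 (proj2 (proj2 Hchain)).
Let pi_pos : forall x, (x < N)%nat -> 0 < pi x := proj1 (proj2 (proj2 (proj2 Hchain))).

Lemma stationary y : (y < N)%nat -> fsum N (fun x => pi x * K x y) = pi y.
Proof.
  intros Hy. rewrite <- (Rmult_1_r (pi y)), <- (K_sum y Hy), <- fsum_scal.
  apply fsum_ext. intros. apply Hrev; assumption.
Qed.

Lemma distr_nonneg k y : (y < N)%nat -> 0 <= distr N mu K k y.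
Proof.
  revert y. induction k as [|k IH]; intros y Hy.
  - rewrite distr_0 by assumption. apply Hmu, Hy.
  - rewrite distr_S. apply fsum_nonneg. intros. apply Rmult_le_pos; auto.
Qed.

Lemma distr_sum k : fsum N (distr N mu K k) = 1.
Proof.
  induction k as [|k IH].
  - rewrite <- (proj2 Hmu). apply fsum_ext. intros. apply distr_0. assumption.
  - transitivity (fsum N (fun y => fsum N (fun x => distr N mu K k x * K x y))).
    { apply fsum_ext. intros. apply distr_S. }
    rewrite fsum_swap, <- IH. apply fsum_ext. intros x Hx.
    rewrite fsum_scal, K_sum by assumption. ring.
Qed.

Lemma distr_le_1 k y : (y < N)%nat -> distr N mu K k y <= 1.
Proof.
  intros Hy. rewrite <- (distr_sum k). apply fsum_ge_term; [|exact Hy].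
  intros. apply distr_nonneg. assumption.
Qed.

Let dev k y := distr N mu K k y - pi y.

Lemma deviation_S k y : (y < N)%nat -> dev (S k) y = fsum N (fun x => dev k x * K x y).
Proof.
  intros Hy. unfold dev. rewrite distr_S, <- (stationary y Hy) at 1.
  rewrite <- fsum_minus. apply fsum_ext. intros. ring.
Qed.

(** Both probabilities lie in [0, 1]. The uniformity in [k] is what later confines the spectrum to
    [-1, 1]. *)
Lemma deviation_bound k y : (y < N)%nat -> -1 <= dev k y <= 1.
Proof.
  intros Hy. pose proof (distr_nonneg k y Hy). pose proof (distr_le_1 k y Hy).
  assert (pi y <= 1).
  { rewrite <- (proj2 (proj2 (proj2 (proj2 Hchain)))).
    apply fsum_ge_term; [|exact Hy]. intros. left. auto. }
  pose proof (pi_pos y Hy). unfold dev. lra.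
Qed.

(** Reversibility makes K(x,y)/pi(y) symmetric in x and y, so the action of [K] on row vectors is
    self-adjoint for the inner product weighted by 1/pi. *)
Lemma kernel_self_adjoint f g :
  fsum N (fun y => fsum N (fun x => f x * K x y) * g y / pi y) =
  fsum N (fun y => f y * fsum N (fun x => g x * K x y) / pi y).
Proof.
  transitivity (fsum N (fun y => fsum N (fun x => f x * g y * (K x y / pi y)))).
  { apply fsum_ext. intros y _. unfold Rdiv. rewrite Rmult_assoc, Rmult_comm, <- fsum_scal.
    apply fsum_ext. intros. ring. }
  rewrite fsum_swap. apply fsum_ext. intros x Hx.
  unfold Rdiv at 2. rewrite Rmult_assoc, (Rmult_comm _ (/ pi x)), <- Rmult_assoc, <- fsum_scal.
  apply fsum_ext. intros y Hy.
  pose proof (pi_pos x Hx). pose proof (pi_pos y Hy).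
  replace (K x y / pi y) with (K y x / pi x); [unfold Rdiv; ring|].
  apply (Rmult_eq_reg_l (pi x * pi y)); [|nra].
  transitivity (pi y * K y x); [field; lra|].
  rewrite <- Hrev by assumption. field. lra.
Qed.

(** Self-adjointness moves the factors [K] one at a time from the right argument to the left one, so
    the inner product depends only on [k + l]. *)
Lemma deviation_moments_shift k l :
  fsum N (fun y => dev k y * dev l y / pi y) =
  fsum N (fun y => dev (k + l) y * dev 0 y / pi y).
Proof.
  revert k. induction l as [|l IH]; intros k; [rewrite Nat.add_0_r; reflexivity|].
  rewrite Nat.add_succ_r, <- Nat.add_succ_l, <- IH.
  transitivity (fsum N (fun y => dev k y * fsum N (fun x => dev l x * K x y) / pi y)).
  { apply fsum_ext. intros. rewrite deviation_S by assumption. reflexivity. }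
  rewrite <- kernel_self_adjoint.
  apply fsum_ext. intros. rewrite (deviation_S k) by assumption. reflexivity.
Qed.

(* Conjugating by sqrt(pi) makes K symmetric. *)
Lemma deviation_moments_raw :
  exists w b : nat -> R, (forall i, (i < N)%nat -> 0 <= w i) /\
    forall k l, fsum N (fun y => dev k y * dev l y / pi y) =
                fsum N (fun i => w i * b i ^ (k + l)).
Proof.
  assert (Hs : forall x, (x < N)%nat -> 0 < sqrt (pi x) /\ pi x = sqrt (pi x) * sqrt (pi x)).
  { intros x Hx. split; [apply sqrt_lt_R0; auto|].
    symmetry. apply sqrt_sqrt. left. auto. }
  destruct (SymmetricMoments.self_adjoint_moments N
    (fun x y => sqrt (pi x) / sqrt (pi y) * K x y) (fun k y => dev k y / sqrt (pi y)))
    as [w [b [Hw Hwb]]].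
  - intros x y Hx Hy. destruct (Hs x Hx) as [Px Ex]. destruct (Hs y Hy) as [Py Ey].
    pose proof (Hrev x y Hx Hy) as HR. rewrite Ex, Ey in HR.
    apply (Rmult_eq_reg_l (sqrt (pi x) * sqrt (pi y))); [|nra].
    transitivity (sqrt (pi x) * sqrt (pi x) * K x y); [field; lra|].
    rewrite HR. field. lra.
  - intros k y Hy. rewrite deviation_S by exact Hy.
    unfold Rdiv at 1. rewrite Rmult_comm, <- fsum_scal.
    apply fsum_ext. intros x Hx. destruct (Hs x Hx). destruct (Hs y Hy). field. lra.
  - exists w, b. split; [exact Hw|]. intros k l.
    rewrite deviation_moments_shift, <- Hwb. apply fsum_ext. intros y Hy.
    destruct (Hs y Hy) as [Py Ey]. rewrite Ey at 1. field. lra.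
Qed.

(* The moments stay bounded, so atoms of positive weight lie in [-1, 1]. *)
Lemma deviation_moments :
  exists w b : nat -> R,
    (forall i, (i < N)%nat -> 0 <= w i) /\ (forall i, (i < N)%nat -> -1 <= b i <= 1) /\
    forall k l, fsum N (fun y => dev k y * dev l y / pi y) =
                fsum N (fun i => w i * b i ^ (k + l)).
Proof.
  destruct deviation_moments_raw as [w [b [Hw Hwb]]].
  (* Boundedness says nothing about atoms of weight 0; these are moved to 0, which changes no
     moment. *)
  exists w, (fun i => if Req_dec_T (w i) 0 then 0 else b i).
  split; [exact Hw|]. split.
  - intros i Hi. destruct (Req_dec_T (w i) 0) as [|Hne]; [lra|].
    assert (Hpos : 0 < w i) by (pose proof (Hw i Hi); lra).
    enough (Rabs (b i) <= 1) by (unfold Rabs in *; destruct (Rcase_abs (b i)); lra).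
    apply Rnot_lt_le. intros Hgt.
    (* Since [dev] is bounded by 1, [B] bounds every even moment, whereas an atom outside [-1, 1]
       would contribute at least [B + 1] to some even moment. *)
    set (B := fsum N (fun y => / pi y)).
    destruct (Pow_x_infinity (b i) Hgt ((B + 1) / w i)) as [n Hn].
    specialize (Hn (n + n)%nat ltac:(lia)).
    assert (Hsq : 0 <= b i ^ (n + n)) by (rewrite pow_add; nra).
    rewrite Rabs_pos_eq in Hn by exact Hsq.
    assert (H1 : w i * b i ^ (n + n) <= fsum N (fun i => w i * b i ^ (n + n))).
    { apply (fsum_ge_term N (fun i => w i * b i ^ (n + n))); [|exact Hi].
      intros j Hj. apply Rmult_le_pos; [auto|rewrite pow_add; nra]. }
    rewrite <- Hwb in H1.
    assert (H2 : fsum N (fun y => dev n y * dev n y / pi y) <= B).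
    { apply fsum_le. intros y Hy. pose proof (deviation_bound n y Hy).
      rewrite <- (Rmult_1_l (/ pi y)). apply Rmult_le_compat_r; [|nra].
      left. apply Rinv_0_lt_compat. auto. }
    assert (H3 : w i * ((B + 1) / w i) <= w i * b i ^ (n + n)).
    { apply Rmult_le_compat_l; lra. }
    replace (w i * ((B + 1) / w i)) with (B + 1) in H3 by (field; lra). lra.
  - intros k l. rewrite Hwb. apply fsum_ext. intros i _.
    destruct (Req_dec_T (w i) 0) as [E|]; [rewrite E; ring|reflexivity].
Qed.

(* [calculus f h] says that f = (mu - pi) h(K) as a row vector. *)
Inductive calculus : (nat -> R) -> (R -> R) -> Prop :=
| calculus_dev k : calculus (dev k) (fun x => x ^ k)
| calculus_linear a c f g h j : calculus f h -> calculus g j ->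
    calculus (fun y => a * f y + c * g y) (fun x => a * h x + c * j x)
| calculus_ext f g h j : (forall y, (y < N)%nat -> f y = g y) -> (forall x, h x = j x) ->
    calculus f h -> calculus g j.

(** One step of [K] sends [dev k] to [dev (S k)], hence multiplies the symbol by x; linearity does
    the rest. *)
Lemma calculus_kernel f h :
  calculus f h -> calculus (fun y => fsum N (fun x => f x * K x y)) (fun x => x * h x).
Proof.
  induction 1 as [k|a c f g h j _ IHf _ IHg|f g h j Hfg Hhj _ IH].
  - apply (calculus_ext (dev (S k)) _ (fun x => x ^ S k) _ (deviation_S k));
      [reflexivity|apply calculus_dev].
  - refine (calculus_ext _ _ _ _ _ _ (calculus_linear a c _ _ _ _ IHf IHg)).
    + intros y _. rewrite <- fsum_linear. apply fsum_ext. intros. ring.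
    + intros. ring.
  - refine (calculus_ext _ _ _ _ _ _ IH).
    + intros y _. apply fsum_ext. intros. rewrite Hfg by assumption. reflexivity.
    + intros. rewrite Hhj. reflexivity.
Qed.

(** * Parseval identity and the two distances *)

Section Parseval.
Context (w b : nat -> R).
Context (Hwb : forall k l, fsum N (fun y => dev k y * dev l y / pi y) =
                           fsum N (fun i => w i * b i ^ (k + l))).

(** Both sides are bilinear, so two nested inductions reduce the identity to a pair of powers, where
    it is [Hwb]. *)
Lemma calculus_inner f h g j : calculus f h -> calculus g j ->
  fsum N (fun y => f y * g y / pi y) = fsum N (fun i => w i * (h (b i) * j (b i))).
Proof.
  intros Hf Hg.
  induction Hf as [k|a c f f' h h' _ IHf _ IHf'|f f' h h' Hff Hhh _ IH].
  - induction Hg as [l|a c g g' j j' _ IHg _ IHg'|g g' j j' Hgg Hjj _ IH].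
    + rewrite Hwb. apply fsum_ext. intros. rewrite pow_add. reflexivity.
    + transitivity (fsum N (fun y => a * (dev k y * g y / pi y) + c * (dev k y * g' y / pi y))).
      { apply fsum_ext. intros. unfold Rdiv. ring. }
      rewrite fsum_linear, IHg, IHg', <- fsum_linear. apply fsum_ext. intros. ring.
    + transitivity (fsum N (fun y => dev k y * g y / pi y)).
      { apply fsum_ext. intros. rewrite Hgg by assumption. reflexivity. }
      rewrite IH. apply fsum_ext. intros. rewrite Hjj. reflexivity.
  - transitivity (fsum N (fun y => a * (f y * g y / pi y) + c * (f' y * g y / pi y))).
    { apply fsum_ext. intros. unfold Rdiv. ring. }
    rewrite fsum_linear, IHf, IHf', <- fsum_linear. apply fsum_ext. intros. ring.
  - transitivity (fsum N (fun y => f y * g y / pi y)).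
    { apply fsum_ext. intros. rewrite Hff by assumption. reflexivity. }
    rewrite IH. apply fsum_ext. intros. rewrite Hhh. reflexivity.
Qed.

Lemma l2dist_deviation nu :
  l2dist N pi nu = sqrt (fsum N (fun y => (nu y - pi y) * (nu y - pi y) / pi y)).
Proof.
  unfold l2dist. f_equal. apply fsum_ext. intros y Hy.
  pose proof (pi_pos y Hy). field. lra.
Qed.

(** As [pi] is stationary for [K], one lazy step acts on the deviation as theta I + (1 - theta) K,
    whose symbol is theta + (1 - theta) x. *)
Lemma calculus_lazy theta m :
  calculus (fun y => distr N mu (lazyK theta K) m y - pi y)
           (fun x => (theta + (1 - theta) * x) ^ m).
Proof.
  induction m as [|m IH].
  - refine (calculus_ext _ _ _ _ _ _ (calculus_dev 0)); [|reflexivity].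
    intros y Hy. unfold dev. rewrite !distr_0 by exact Hy. reflexivity.
  - refine (calculus_ext _ _ _ _ _ _
      (calculus_linear theta (1 - theta) _ _ _ _ IH (calculus_kernel _ _ IH))).
    + intros y Hy. rewrite distr_S.
      set (f := distr N mu (lazyK theta K) m).
      transitivity (theta * (f y - pi y) + (1 - theta) * (fsum N (fun x => f x * K x y) - pi y)).
      { f_equal. f_equal. rewrite <- (stationary y Hy) at 1.
        rewrite <- fsum_minus. apply fsum_ext. intros. ring. }
      rewrite <- (fsum_delta N f y Hy).
      transitivity (theta * fsum N (fun x => f x * delta x y) +
        (1 - theta) * fsum N (fun x => f x * K x y) - pi y); [ring|].
      rewrite <- fsum_linear. f_equal. apply fsum_ext. intros. unfold lazyK. ring.
    + intros. simpl. ring.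
Qed.

Lemma d2_disc_spectral theta m :
  d2_disc N (lazyK theta K) pi mu m =
  sqrt (fsum N (fun i => w i * (theta + (1 - theta) * b i) ^ (2 * m))).
Proof.
  unfold d2_disc. rewrite l2dist_deviation. f_equal.
  rewrite (calculus_inner _ _ _ _ (calculus_lazy theta m) (calculus_lazy theta m)).
  apply fsum_ext. intros. simpl. rewrite Nat.add_0_r, pow_add. reflexivity.
Qed.

(** [calculus] reaches only polynomial symbols, so the heat semigroup is approached through its
    partial sums. *)
Lemma calculus_sum (c : nat -> R) M :
  calculus (fun y => sum_f_R0 (fun k => c k * dev k y) M)
           (fun x => sum_f_R0 (fun k => c k * x ^ k) M).
Proof.
  induction M as [|M IH].
  - refine (calculus_ext _ _ _ _ _ _
      (calculus_linear (c 0%nat) 0 _ _ _ _ (calculus_dev 0) (calculus_dev 0)));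
      intros; simpl; ring.
  - refine (calculus_ext _ _ _ _ _ _
      (calculus_linear 1 (c (S M)) _ _ _ _ IH (calculus_dev (S M))));
      intros; simpl; ring.
Qed.

Lemma exp_series_cv t x :
  Un_cv (fun M => sum_f_R0 (fun k => exp (- t) * (t ^ k / INR (fact k)) * x ^ k) M)
        (exp (- t) * exp (t * x)).
Proof.
  apply Un_cv_ext with
    (fun M => exp (- t) * sum_f_R0 (fun k => / INR (fact k) * (t * x) ^ k) M).
  - intros M. rewrite scal_sum. apply sum_eq. intros. rewrite Rpow_mult_distr.
    unfold Rdiv. ring.
  - apply CV_mult; [apply Un_cv_const|].
    unfold exp. destruct (exist_exp (t * x)) as [l Hl]. exact Hl.
Qed.

(** [series_val] is an [epsilon] and carries information only once the series is known to converge;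
    comparison with the exponential series shows that. *)
Lemma heat_deviation_cv t y : 0 <= t -> (y < N)%nat ->
  Un_cv (fun M => sum_f_R0 (fun k => exp (- t) * (t ^ k / INR (fact k)) * dev k y) M)
        (heat N K mu t y - pi y).
Proof.
  intros Ht Hy.
  set (u := fun k => t ^ k / INR (fact k) * distr N mu K k y).
  assert (Hser : infinite_sum u (series_val u)).
  { unfold series_val. apply epsilon_spec.
    destruct (Rseries_CV_comp u (fun k => / INR (fact k) * t ^ k)) as [l Hl].
    - intros k. unfold u. pose proof (distr_nonneg k y Hy). pose proof (distr_le_1 k y Hy).
      assert (0 <= t ^ k / INR (fact k)).
      { apply Rmult_le_pos; [apply pow_le, Ht|].
        left. apply Rinv_0_lt_compat, INR_fact_lt_0. }
      split; [apply Rmult_le_pos; assumption|]. unfold Rdiv in *. nra.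
    - destruct (exist_exp t) as [l Hl]. exists l. exact Hl.
    - exists l. exact Hl. }
  (* [pi y] is written as [pi y] times the normalised exponential series at x = 1, so that the
     subtraction can be done term by term. *)
  apply Un_cv_ext with (fun M => exp (- t) * sum_f_R0 u M -
    pi y * sum_f_R0 (fun k => exp (- t) * (t ^ k / INR (fact k)) * 1 ^ k) M).
  - intros M. rewrite !scal_sum, <- minus_sum. apply sum_eq. intros k _.
    unfold u, dev. rewrite pow1. ring.
  - replace (heat N K mu t y - pi y)
      with (exp (- t) * series_val u - pi y * (exp (- t) * exp (t * 1))).
    + apply CV_minus; (apply CV_mult; [apply Un_cv_const|]); [exact Hser|apply exp_series_cv].
    + rewrite Rmult_1_r, <- exp_plus, Rplus_opp_l, exp_0, Rmult_1_r. reflexivity.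
Qed.

Lemma d2_cont_spectral t : 0 <= t ->
  d2_cont N K pi mu t = sqrt (fsum N (fun i => w i * exp (- (2 * t * (1 - b i))))).
Proof.
  intros Ht. unfold d2_cont. rewrite l2dist_deviation. f_equal.
  set (c := fun k => exp (- t) * (t ^ k / INR (fact k))).
  (* The squared norms of the partial sums converge to one side when computed in space and to the
     other when computed on the spectrum. *)
  apply (UL_sequence (fun M => fsum N (fun y =>
    sum_f_R0 (fun k => c k * dev k y) M * sum_f_R0 (fun k => c k * dev k y) M / pi y))).
  - apply (fsum_cv N (fun M y =>
      sum_f_R0 (fun k => c k * dev k y) M * sum_f_R0 (fun k => c k * dev k y) M / pi y)).
    intros y Hy. apply CV_mult; [|apply Un_cv_const].
    apply CV_mult; apply heat_deviation_cv; assumption.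
  - apply Un_cv_ext with (fun M => fsum N (fun i =>
      w i * (sum_f_R0 (fun k => c k * b i ^ k) M * sum_f_R0 (fun k => c k * b i ^ k) M))).
    { intros M. symmetry. exact (calculus_inner _ _ _ _ (calculus_sum c M) (calculus_sum c M)). }
    apply (fsum_cv N (fun M i =>
      w i * (sum_f_R0 (fun k => c k * b i ^ k) M * sum_f_R0 (fun k => c k * b i ^ k) M))
      (fun i => w i * exp (- (2 * t * (1 - b i))))).
    intros i _. apply CV_mult; [apply Un_cv_const|].
    replace (exp (- (2 * t * (1 - b i))))
      with ((exp (- t) * exp (t * b i)) * (exp (- t) * exp (t * b i))).
    + apply CV_mult; apply exp_series_cv.
    + rewrite <- !exp_plus. f_equal. ring.
Qed.

End Parseval.

(** The same weights and eigenvalues serve all times, all [theta] and both kinds of time, which is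
    what makes the families comparable. *)
Lemma spectral_representation :
  exists w l : nat -> R,
    (forall i, (i < N)%nat -> 0 <= w i) /\ (forall i, (i < N)%nat -> 0 <= l i <= 2) /\
    (forall t, 0 <= t ->
       d2_cont N K pi mu t = sqrt (fsum N (fun i => w i * exp (- (2 * t * l i))))) /\
    (forall theta m,
       d2_disc N (lazyK theta K) pi mu m =
       sqrt (fsum N (fun i => w i * (1 - (1 - theta) * l i) ^ (2 * m)))).
Proof.
  destruct deviation_moments as [w [b [Hw [Hb Hwb]]]].
  exists w, (fun i => 1 - b i). split; [exact Hw|]. split.
  { intros i Hi. pose proof (Hb i Hi). lra. }
  split; [apply d2_cont_spectral; exact Hwb|].
  intros theta m. rewrite (d2_disc_spectral w b Hwb). f_equal. apply fsum_ext.
  intros. f_equal. f_equal. ring.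
Qed.
End Chain.

(** * Energy decay and cutoff *)

Definition eventually (P : nat -> Prop) : Prop :=
  exists n0, forall n, (n0 <= n)%nat -> P n.

Lemma eventually_imp (P Q : nat -> Prop) :
  (forall n, P n -> Q n) -> eventually P -> eventually Q.
Proof. intros H [n0 Hn]. exists n0. auto. Qed.

Lemma eventually_and (P Q : nat -> Prop) :
  eventually P -> eventually Q -> eventually (fun n => P n /\ Q n).
Proof.
  intros [n0 H0] [n1 H1]. exists (max n0 n1). intros n Hn. split; [apply H0|apply H1]; lia.
Qed.

Lemma cv_infty_eventually u : cv_infty u <-> forall M, eventually (fun n => M <= u n).
Proof.
  split; intros H M.
  - destruct (H M) as [n0 Hn]. exists n0. intros n H0. left. apply Hn, H0.
  - destruct (H (M + 1)) as [n0 Hn]. exists n0. intros n H0. specialize (Hn n H0). lra.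
Qed.

Lemma sqrt_cv_0 u : (forall n, 0 <= u n) ->
  (Un_cv (fun n => sqrt (u n)) 0 <-> forall e, 0 < e -> eventually (fun n => u n <= e)).
Proof.
  intros Hu. split; intros H e He.
  - destruct (H (sqrt e) (sqrt_lt_R0 e He)) as [n0 Hn]. exists n0. intros n H0.
    specialize (Hn n H0). unfold Rdist in Hn. rewrite Rminus_0_r in Hn.
    rewrite Rabs_pos_eq in Hn by apply sqrt_pos.
    left. apply sqrt_lt_0_alt, Hn.
  (* Aiming at (e/2)^2 turns the weak inequality into the strict one required by [Un_cv]. *)
  - destruct (H (e * e / 4)) as [n0 Hn]; [nra|]. exists n0. intros n H0.
    specialize (Hn n H0). unfold Rdist. rewrite Rminus_0_r, Rabs_pos_eq by apply sqrt_pos.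
    apply Rle_lt_trans with (sqrt ((e / 2) * (e / 2))).
    + apply sqrt_le_1_alt. lra.
    + rewrite sqrt_square; lra.
Qed.

Lemma sqrt_cv_infty u : (forall n, 0 <= u n) ->
  (cv_infty (fun n => sqrt (u n)) <-> forall M, eventually (fun n => M <= u n)).
Proof.
  intros Hu. rewrite cv_infty_eventually. split; intros H M.
  - refine (eventually_imp _ _ _ (H (Rabs M + 1))). intros n Hn.
    pose proof (Rle_abs M). pose proof (Rabs_pos M). pose proof (sqrt_sqrt _ (Hu n)). nra.
  - refine (eventually_imp _ _ _ (H (M * M))). intros n Hn.
    apply Rle_trans with (Rabs M); [apply Rle_abs|].
    rewrite <- sqrt_Rsqr_abs. apply sqrt_le_1_alt, Hn.
Qed.

Lemma sqrt_le_iff x e : 0 <= x -> 0 < e -> (sqrt x <= e <-> x <= e * e).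
Proof.
  intros Hx He. split; intros H.
  - pose proof (sqrt_sqrt x Hx). pose proof (sqrt_pos x). nra.
  - rewrite <- (sqrt_square e) by lra. apply sqrt_le_1_alt, H.
Qed.

Lemma nat_floor_spec x : 0 <= x -> INR (nat_floor x) <= x < INR (nat_floor x) + 1.
Proof.
  intros Hx. unfold nat_floor. destruct (base_Int_part x) as [H1 H2].
  assert (0 <= Int_part x)%Z.
  { assert (-1 < Int_part x)%Z; [|lia]. apply lt_IZR. simpl. lra. }
  rewrite INR_IZR_INZ, Z2Nat.id by assumption. lra.
Qed.

Lemma nat_ceil_spec x : 0 <= x -> x <= INR (nat_ceil x) < x + 1.
Proof.
  intros Hx. unfold nat_ceil. destruct (base_Int_part (- x)) as [H1 H2].
  assert (0 <= - Int_part (- x))%Z.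
  { assert (Int_part (- x) <= 0)%Z; [|lia]. apply le_IZR. lra. }
  rewrite INR_IZR_INZ, Z2Nat.id, opp_IZR by assumption. lra.
Qed.

Lemma exp_le x y : x <= y -> exp x <= exp y.
Proof. intros [H| ->]; [left; apply exp_increasing, H|apply Rle_refl]. Qed.

Lemma exp_neg_le_1 x : 0 <= x -> exp (- x) <= 1.
Proof. intros H. rewrite <- exp_0. apply exp_le. lra. Qed.

Lemma exp_pow x m : exp x ^ m = exp (INR m * x).
Proof.
  induction m as [|m IH]; [simpl; rewrite Rmult_0_l, exp_0; reflexivity|].
  rewrite S_INR, Rmult_plus_distr_r, exp_plus, <- IH, Rmult_1_l. simpl. ring.
Qed.

Lemma pow_unit_le_1 x m : 0 <= x <= 1 -> x ^ m <= 1.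
Proof. intros H. pose proof (pow_incr x 1 m H). rewrite pow1 in *. assumption. Qed.

Lemma INR_double m : INR (2 * m) = 2 * INR m.
Proof. rewrite mult_INR. reflexivity. Qed.

Lemma exp_decay_unbounded x M : 0 < x -> exists L, 0 < L /\ M <= exp (x * L).
Proof.
  intros Hx. exists ((Rabs M + 1) / x). pose proof (Rabs_pos M). split.
  - apply Rdiv_lt_0_compat; lra.
  - replace (x * ((Rabs M + 1) / x)) with (Rabs M + 1) by (field; lra).
    pose proof (exp_ineq1_le (Rabs M + 1)). pose proof (Rle_abs M). lra.
Qed.

Lemma exp_decay_small x e : 0 < x -> 0 < e -> exists L, 0 < L /\ exp (- (x * L)) <= e.
Proof.
  intros Hx He. destruct (exp_decay_unbounded x (/ e) Hx) as [L [HL H]].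
  exists L. split; [exact HL|]. rewrite exp_Ropp, <- (Rinv_inv e).
  apply Rinv_le_contravar; [apply Rinv_0_lt_compat, He|exact H].
Qed.

(* Convexity of the exponential: [exp y] lies below the chord through [0] and [ln p]. *)
Lemma exp_chord p x : 0 < p -> 0 <= x <= 1 -> exp (x * ln p) <= 1 - x + x * p.
Proof.
  intros Hp Hx. remember (x * ln p) as y eqn:Hy.
  assert (H1 : exp y * (1 - y) <= 1).
  { rewrite <- exp_0 at 2. replace 0 with (y + - y) by ring. rewrite exp_plus.
    apply Rmult_le_compat_l; [left; apply exp_pos|]. pose proof (exp_ineq1_le (- y)). lra. }
  assert (H2 : exp y * (1 + ln p - y) <= p).
  { rewrite <- (exp_ln p Hp) at 2. replace (ln p) with (y + (ln p - y)) at 2 by ring.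
    rewrite exp_plus. apply Rmult_le_compat_l; [left; apply exp_pos|].
    pose proof (exp_ineq1_le (ln p - y)). lra. }
  pose proof (exp_pos y).
  assert (E : exp y = (1 - x) * (exp y * (1 - y)) + x * (exp y * (1 + ln p - y))).
  { transitivity (exp y * (1 - y + x * ln p)); [rewrite <- Hy; ring|ring]. }
  rewrite E. nra.
Qed.

(** From exp(2x) >= 1 + 2x and (1 + 2x)(1 - x) >= 1 on this range. It bounds the lazy factor from
    below at small eigenvalues, including the case theta = 1/2. *)
Lemma exp_neg_double_le x : 0 <= x <= 1 / 2 -> exp (- (2 * x)) <= 1 - x.
Proof.
  intros Hx. rewrite exp_Ropp. pose proof (exp_ineq1_le (2 * x)).
  apply Rle_trans with (/ (1 + 2 * x)); [apply Rinv_le_contravar; lra|].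
  apply (Rmult_le_reg_l (1 + 2 * x)); [lra|]. rewrite Rinv_r by lra. nra.
Qed.

Lemma cv_infty_transfer u v a b : 0 < a -> cv_infty u ->
  eventually (fun n => u n <= a * v n + b) -> cv_infty v.
Proof.
  rewrite !cv_infty_eventually. intros Ha Hu Hle M.
  refine (eventually_imp _ _ _ (eventually_and _ _ (Hu (a * M + b)) Hle)).
  intros n [H1 H2]. apply (Rmult_le_reg_l a); lra.
Qed.

(** The witness [m] makes the set of admissible times nonempty, so that the [epsilon] in [T2_disc]
    picks its least element. *)
Lemma T2_disc_spec (d : nat -> R) eps m : d m <= eps ->
  d (T2_disc d eps) <= eps /\ forall m', d m' <= eps -> (T2_disc d eps <= m')%nat.
Proof.
  intros Hm. unfold T2_disc. apply epsilon_spec.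
  destruct (dec_inh_nat_subset_has_unique_least_element (fun m => d m <= eps))
    as [k [Hk _]].
  - intros k. destruct (Rle_dec (d k) eps); tauto.
  - exists m. exact Hm.
  - exists k. exact Hk.
Qed.

(** * Spectral energies and their comparison *)

Section Decay.
Context (N : nat -> nat) (w l : nat -> nat -> R).
Context (Hw : forall n i, (i < N n)%nat -> 0 <= w n i).
Context (Hl : forall n i, (i < N n)%nat -> 0 <= l n i <= 2).

Definition cont_energy n t := fsum (N n) (fun i => w n i * exp (- (2 * t * l n i))).
Definition lazy_energy theta n m :=
  fsum (N n) (fun i => w n i * (1 - (1 - theta) * l n i) ^ (2 * m)).
Definition low_mass n x := fsum (N n) (fun i => if Rle_dec (l n i) x then w n i else 0).

Lemma cont_energy_nonneg n t : 0 <= cont_energy n t.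
Proof.
  apply fsum_nonneg. intros. apply Rmult_le_pos; [auto|left; apply exp_pos].
Qed.

Lemma lazy_energy_nonneg theta n m : 0 <= lazy_energy theta n m.
Proof.
  apply fsum_nonneg. intros. apply Rmult_le_pos; [auto|].
  rewrite pow_mult. apply pow_le, pow2_ge_0.
Qed.

Lemma low_mass_mono n x y : x <= y -> low_mass n x <= low_mass n y.
Proof.
  intros Hxy. apply fsum_le. intros i Hi. pose proof (Hw n i Hi).
  destruct (Rle_dec (l n i) x), (Rle_dec (l n i) y); lra.
Qed.

Lemma cont_energy_mono n s t : s <= t -> cont_energy n t <= cont_energy n s.
Proof.
  intros Hst. apply fsum_le. intros i Hi. apply Rmult_le_compat_l; [auto|].
  apply exp_le. pose proof (Hl n i Hi). nra.
Qed.

(** Each exponential decays at rate 2l <= 4. This quantitative continuity shows that the continuous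
    mixing time is attained. *)
Lemma cont_energy_log_lipschitz n t h : 0 <= h ->
  cont_energy n t <= exp (4 * h) * cont_energy n (t + h).
Proof.
  intros Hh. unfold cont_energy. rewrite <- fsum_scal. apply fsum_le. intros i Hi.
  rewrite <- (Rmult_assoc (exp _)), (Rmult_comm (exp (4 * h))), (Rmult_assoc (w n i)).
  apply Rmult_le_compat_l; [auto|]. rewrite <- exp_plus. apply exp_le.
  pose proof (Hl n i Hi). nra.
Qed.

(** With l <= 2, laziness at least 1/2 makes the lazy spectrum nonnegative, so bounds on the factors
    may be raised to powers. *)
Lemma lazy_factor_nonneg theta n i : 1 / 2 <= theta < 1 -> (i < N n)%nat ->
  0 <= 1 - (1 - theta) * l n i <= 1.
Proof. intros Ht Hi. pose proof (Hl n i Hi). nra. Qed.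

Lemma lazy_factor_pow_le theta n i k : 1 / 2 <= theta < 1 -> (i < N n)%nat ->
  (1 - (1 - theta) * l n i) ^ (2 * k) <= exp (- (2 * ((1 - theta) * INR k) * l n i)).
Proof.
  intros Ht Hi. apply Rle_trans with (exp (- ((1 - theta) * l n i)) ^ (2 * k)).
  - apply pow_incr. split; [apply lazy_factor_nonneg; assumption|].
    pose proof (exp_ineq1_le (- ((1 - theta) * l n i))). lra.
  - rewrite exp_pow, INR_double. apply exp_le. lra.
Qed.

Lemma lazy_energy_mono theta n m k : 1 / 2 <= theta < 1 -> (m <= k)%nat ->
  lazy_energy theta n k <= lazy_energy theta n m.
Proof.
  intros Ht Hmk. apply fsum_le. intros i Hi. apply Rmult_le_compat_l; [auto|].
  pose proof (lazy_factor_nonneg theta n i Ht Hi) as Hq.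
  replace (2 * k)%nat with (2 * m + 2 * (k - m))%nat by lia.
  rewrite pow_add. rewrite <- (Rmult_1_r (_ ^ (2 * m))) at 2.
  apply Rmult_le_compat_l; [apply pow_le; lra|].
  apply pow_unit_le_1, Hq.
Qed.

Lemma lazy_energy_le_cont theta n m : 1 / 2 <= theta < 1 ->
  lazy_energy theta n m <= cont_energy n ((1 - theta) * INR m).
Proof.
  intros Ht. apply fsum_le. intros i Hi. apply Rmult_le_compat_l; [auto|].
  apply lazy_factor_pow_le; assumption.
Qed.

(** The chord bound at x = l/2 with p = 2 theta - 1: there 1 - x + x p equals 1 - (1 - theta) l. *)
Lemma cont_energy_le_lazy theta n m : 1 / 2 < theta < 1 ->
  cont_energy n (- ln (2 * theta - 1) / 2 * INR m) <= lazy_energy theta n m.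
Proof.
  intros Ht. apply fsum_le. intros i Hi. apply Rmult_le_compat_l; [auto|].
  pose proof (Hl n i Hi).
  apply Rle_trans with (exp (l n i / 2 * ln (2 * theta - 1)) ^ (2 * m)).
  - rewrite exp_pow, INR_double. apply exp_le. lra.
  - apply pow_incr. split; [left; apply exp_pos|].
    pose proof (exp_chord (2 * theta - 1) (l n i / 2)). lra.
Qed.

(** * Negligible low spectral mass *)

(* The scale-invariant criterion for cutoff at times [t n]: no spectral mass survives on the
   eigenvalues of order [1 / t n]. *)
Definition spectrally_negligible (t : nat -> R) : Prop :=
  forall L e, 0 < L -> 0 < e -> eventually (fun n => low_mass n (L / t n) <= e).

(** Since [L] is arbitrary in the criterion, the factor [k] is absorbed by using L/k. *)
Lemma spectrally_negligible_slower t r k : 0 < k -> spectrally_negligible t ->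
  eventually (fun n => 0 < t n) -> eventually (fun n => k * t n <= r n) ->
  spectrally_negligible r.
Proof.
  intros Hk Ht Hpos Hle L e HL He.
  refine (eventually_imp _ _ _ (eventually_and _ _ (Ht (L / k) e _ He)
    (eventually_and _ _ Hpos Hle))); [|apply Rdiv_lt_0_compat; assumption].
  intros n [H1 [H2 H3]]. apply Rle_trans with (2 := H1). apply low_mass_mono.
  replace (L / k / t n) with (L / (k * t n)) by (field; lra).
  unfold Rdiv. apply Rmult_le_compat_l; [lra|]. apply Rinv_le_contravar; [nra|exact H3].
Qed.

(** At time 3t/2 an eigenvalue l <= L/t still keeps the fraction exp(-3L) of its weight, so
    vanishing energy forces vanishing low mass. *)
Lemma cont_decay_negligible t : (forall n, 0 < t n) ->
  (forall e, 0 < e -> eventually (fun n => cont_energy n ((1 + 1 / 2) * t n) <= e)) ->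
  spectrally_negligible t.
Proof.
  intros Hpos H L e HL He.
  refine (eventually_imp _ _ _ (H (exp (- (3 * L)) * e) _));
    [|apply Rmult_lt_0_compat; [apply exp_pos|exact He]].
  intros n Hn. apply (Rmult_le_reg_l (exp (- (3 * L)))); [apply exp_pos|].
  apply Rle_trans with (2 := Hn). unfold low_mass. rewrite <- fsum_scal.
  apply fsum_le. intros i Hi. pose proof (Hw n i Hi). pose proof (Hl n i Hi).
  pose proof (Hpos n). pose proof (exp_pos (- (2 * ((1 + 1 / 2) * t n) * l n i))).
  destruct (Rle_dec (l n i) (L / t n)) as [Hle|]; [|nra].
  rewrite Rmult_comm. apply Rmult_le_compat_l; [assumption|]. apply exp_le.
  apply (Rmult_le_compat_r (t n)) in Hle; [|lra].
  replace (L / t n * t n) with L in Hle by (field; lra). lra.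
Qed.

(** The same argument in discrete time. Once t >= 2L the low eigenvalues are at most 1/2, so the
    lazy factor is at least exp(-2l); once t >= 2 the rounded time is at most 2t, whence the
    fraction exp(-8L). *)
Lemma lazy_decay_negligible theta t : 1 / 2 <= theta < 1 -> cv_infty t ->
  (forall e, 0 < e ->
     eventually (fun n => lazy_energy theta n (nat_ceil ((1 + 1 / 2) * t n)) <= e)) ->
  spectrally_negligible t.
Proof.
  intros Hth Ht H L e HL He. rewrite cv_infty_eventually in Ht.
  refine (eventually_imp _ _ _ (eventually_and _ _ (H (exp (- (8 * L)) * e) _)
    (eventually_and _ _ (Ht 2) (Ht (2 * L)))));
    [|apply Rmult_lt_0_compat; [apply exp_pos|exact He]].
  intros n [Hn [Ht2 HtL]]. apply (Rmult_le_reg_l (exp (- (8 * L)))); [apply exp_pos|].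
  apply Rle_trans with (2 := Hn). unfold low_mass. rewrite <- fsum_scal.
  apply fsum_le. intros i Hi. pose proof (Hw n i Hi). pose proof (Hl n i Hi).
  pose proof (nat_ceil_spec ((1 + 1 / 2) * t n) ltac:(lra)) as Hm.
  set (m := nat_ceil ((1 + 1 / 2) * t n)) in *.
  assert (Hq := lazy_factor_nonneg theta n i Hth Hi).
  assert (0 <= (1 - (1 - theta) * l n i) ^ (2 * m)) by (apply pow_le; lra).
  destruct (Rle_dec (l n i) (L / t n)) as [Hle|]; [|nra].
  rewrite Rmult_comm. apply Rmult_le_compat_l; [assumption|].
  apply (Rmult_le_compat_r (t n)) in Hle; [|lra].
  replace (L / t n * t n) with L in Hle by (field; lra).
  assert (Hhalf : l n i <= 1 / 2) by nra.
  apply Rle_trans with (exp (- (2 * l n i)) ^ (2 * m)).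
  - rewrite exp_pow, INR_double. apply exp_le. nra.
  - apply pow_incr. split; [left; apply exp_pos|].
    apply Rle_trans with (1 - l n i); [apply exp_neg_double_le; lra|nra].
Qed.

(** * From negligible low mass to cutoff *)

(** Split at L/r: low eigenvalues contribute at most their mass, the others lose a factor exp(-2aL)
    during the extra time a r. *)
Lemma cont_energy_after n r a L : 0 < r -> 0 < a -> 0 < L ->
  cont_energy n ((1 + a) * r) <= low_mass n (L / r) + exp (- (2 * a * L)) * cont_energy n r.
Proof.
  intros Hr Ha HL. rewrite <- (Rmult_1_l (low_mass _ _)).
  unfold cont_energy, low_mass. rewrite <- fsum_linear.
  apply fsum_le. intros i Hi. pose proof (Hw n i Hi) as Wi. pose proof (Hl n i Hi) as Li.
  destruct (Rle_dec (l n i) (L / r)) as [Hle|Hgt].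
  - assert (H1 : exp (- (2 * ((1 + a) * r) * l n i)) <= 1).
    { apply exp_neg_le_1. repeat apply Rmult_le_pos; lra. }
    assert (0 <= exp (- (2 * a * L)) * (w n i * exp (- (2 * r * l n i)))).
    { apply Rmult_le_pos; [left; apply exp_pos|].
      apply Rmult_le_pos; [exact Wi|left; apply exp_pos]. }
    pose proof (Rmult_le_compat_l _ _ _ Wi H1). lra.
  - rewrite Rmult_0_r, Rplus_0_l, <- (Rmult_assoc (exp _)), (Rmult_comm (exp (- (2 * a * L)))),
      (Rmult_assoc (w n i)), <- exp_plus.
    apply Rmult_le_compat_l; [exact Wi|]. apply exp_le.
    apply Rnot_le_lt in Hgt. apply (Rmult_lt_compat_r r) in Hgt; [|exact Hr].
    replace (L / r * r) with L in Hgt by (field; lra). nra.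
Qed.

(** The same split run backwards over a time a r/2. It starts from (1 - a/2) r, strictly before [r],
    where the energy is still known to exceed the level. *)
Lemma cont_energy_before n r a L : 0 < r -> 0 < a < 1 -> 0 < L ->
  exp (a * L) * (cont_energy n ((1 - a / 2) * r) - low_mass n (L / r))
    <= cont_energy n ((1 - a) * r).
Proof.
  intros Hr Ha HL.
  unfold cont_energy, low_mass. rewrite <- fsum_minus, <- fsum_scal.
  apply fsum_le. intros i Hi. pose proof (Hw n i Hi) as Wi. pose proof (Hl n i Hi) as Li.
  destruct (Rle_dec (l n i) (L / r)) as [Hle|Hgt].
  - apply Rle_trans with 0.
    + assert (H1 : exp (- (2 * ((1 - a / 2) * r) * l n i)) <= 1).
      { apply exp_neg_le_1. repeat apply Rmult_le_pos; lra. }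
      pose proof (Rmult_le_compat_l _ _ _ Wi H1).
      rewrite <- (Rmult_0_r (exp (a * L))). apply Rmult_le_compat_l; [left; apply exp_pos|lra].
    + apply Rmult_le_pos; [exact Wi|left; apply exp_pos].
  - rewrite Rminus_0_r, <- (Rmult_assoc (exp _)), (Rmult_comm (exp (a * L))),
      (Rmult_assoc (w n i)), <- exp_plus.
    apply Rmult_le_compat_l; [exact Wi|]. apply exp_le.
    apply Rnot_le_lt in Hgt. apply (Rmult_lt_compat_r r) in Hgt; [|exact Hr].
    replace (L / r * r) with L in Hgt by (field; lra). nra.
Qed.

Lemma cont_cutoff_at r : spectrally_negligible r ->
  eventually (fun n => 0 < r n /\ cont_energy n (r n) <= 1 /\
                       forall s, 0 <= s < r n -> 1 < cont_energy n s) ->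
  forall a, 0 < a < 1 ->
    (forall e, 0 < e -> eventually (fun n => cont_energy n ((1 + a) * r n) <= e)) /\
    (forall M, eventually (fun n => M <= cont_energy n ((1 - a) * r n))).
Proof.
  intros Hneg Hr a Ha. split.
  - intros e He. destruct (exp_decay_small (2 * a) (e / 2)) as [L [HL HLe]]; [lra|lra|].
    refine (eventually_imp _ _ _ (eventually_and _ _ Hr (Hneg L (e / 2) HL _))); [|lra].
    intros n [[Hpos [H1 _]] H2].
    pose proof (cont_energy_after n (r n) a L Hpos (proj1 Ha) HL).
    pose proof (exp_pos (- (2 * a * L))). pose proof (cont_energy_nonneg n (r n)). nra.
  (* Energy above 1 minus low mass at most 1/2 leaves at least 1/2, so the amplification must reach
     2|M|. *)
  - intros M. destruct (exp_decay_unbounded a (2 * Rabs M) (proj1 Ha)) as [L [HL HLM]].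
    refine (eventually_imp _ _ _ (eventually_and _ _ Hr (Hneg L (1 / 2) HL _))); [|lra].
    intros n [[Hpos [_ H1]] H2].
    pose proof (cont_energy_before n (r n) a L Hpos Ha HL).
    specialize (H1 ((1 - a / 2) * r n) ltac:(nra)).
    pose proof (Rle_abs M). pose proof (exp_pos (a * L)). nra.
Qed.

Lemma lazy_energy_after theta n S a L m : 1 / 2 <= theta < 1 -> 0 < INR S -> 0 < a -> 0 < L ->
  (1 + a) * INR S <= INR m ->
  lazy_energy theta n m <=
    low_mass n (L / INR S) + exp (- (2 * a * (1 - theta) * L)) * lazy_energy theta n S.
Proof.
  intros Hth HS Ha HL Hm.
  assert (Hle : (S <= m)%nat) by (apply INR_le; nra).
  rewrite <- (Rmult_1_l (low_mass _ _)).
  unfold lazy_energy, low_mass. rewrite <- fsum_linear.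
  apply fsum_le. intros i Hi. pose proof (Hw n i Hi) as Wi. pose proof (Hl n i Hi) as Li.
  pose proof (lazy_factor_nonneg theta n i Hth Hi) as Hq.
  assert (HqS : 0 <= (1 - (1 - theta) * l n i) ^ (2 * S)) by (apply pow_le; lra).
  destruct (Rle_dec (l n i) (L / INR S)) as [Hlow|Hgt].
  - assert (H1 : (1 - (1 - theta) * l n i) ^ (2 * m) <= 1).
    { apply pow_unit_le_1, Hq. }
    assert (0 <= exp (- (2 * a * (1 - theta) * L)) *
                 (w n i * (1 - (1 - theta) * l n i) ^ (2 * S))).
    { apply Rmult_le_pos; [left; apply exp_pos|]. apply Rmult_le_pos; assumption. }
    pose proof (Rmult_le_compat_l _ _ _ Wi H1). lra.
  - apply Rnot_le_lt in Hgt. apply (Rmult_lt_compat_r (INR S)) in Hgt; [|exact HS].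
    replace (L / INR S * INR S) with L in Hgt by (field; lra).
    assert (Hdec : (1 - (1 - theta) * l n i) ^ (2 * (m - S)) <=
                   exp (- (2 * a * (1 - theta) * L))).
    { apply Rle_trans with (1 := lazy_factor_pow_le theta n i (m - S) Hth Hi).
      apply exp_le. rewrite minus_INR by exact Hle.
      assert (a * L <= (INR m - INR S) * l n i) by nra. nra. }
    replace (2 * m)%nat with (2 * S + 2 * (m - S))%nat by lia. rewrite pow_add.
    assert (w n i * (1 - (1 - theta) * l n i) ^ (2 * S) *
            (1 - (1 - theta) * l n i) ^ (2 * (m - S)) <=
            w n i * (1 - (1 - theta) * l n i) ^ (2 * S) * exp (- (2 * a * (1 - theta) * L))).
    { apply Rmult_le_compat_l; [apply Rmult_le_pos; assumption|exact Hdec]. }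
    lra.
Qed.

(** Both integer times are left free, subject only to a gap of a s/2, so that rounding can be
    handled by the caller. *)
Lemma lazy_energy_before theta n s a L m k : 1 / 2 <= theta < 1 -> 0 < s -> 0 < a < 1 -> 0 < L ->
  INR m + a * s / 2 <= INR k ->
  exp (a * (1 - theta) * L) * (lazy_energy theta n k - low_mass n (L / s))
    <= lazy_energy theta n m.
Proof.
  intros Hth Hs Ha HL Hmk.
  assert (Hle : (m <= k)%nat) by (apply INR_le; nra).
  unfold lazy_energy, low_mass. rewrite <- fsum_minus, <- fsum_scal.
  apply fsum_le. intros i Hi. pose proof (Hw n i Hi) as Wi. pose proof (Hl n i Hi) as Li.
  pose proof (lazy_factor_nonneg theta n i Hth Hi) as Hq.
  assert (Hqm : 0 <= (1 - (1 - theta) * l n i) ^ (2 * m)) by (apply pow_le; lra).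
  destruct (Rle_dec (l n i) (L / s)) as [Hlow|Hgt].
  - apply Rle_trans with 0; [|apply Rmult_le_pos; assumption].
    assert (H1 : (1 - (1 - theta) * l n i) ^ (2 * k) <= 1).
    { apply pow_unit_le_1, Hq. }
    pose proof (Rmult_le_compat_l _ _ _ Wi H1).
    rewrite <- (Rmult_0_r (exp (a * (1 - theta) * L))).
    apply Rmult_le_compat_l; [left; apply exp_pos|lra].
  - apply Rnot_le_lt in Hgt. apply (Rmult_lt_compat_r s) in Hgt; [|exact Hs].
    replace (L / s * s) with L in Hgt by (field; lra).
    assert (Hdec : (1 - (1 - theta) * l n i) ^ (2 * (k - m)) <=
                   exp (- (a * (1 - theta) * L))).
    { apply Rle_trans with (1 := lazy_factor_pow_le theta n i (k - m) Hth Hi).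
      apply exp_le. rewrite minus_INR by exact Hle.
      assert (a * L <= 2 * (INR k - INR m) * l n i) by nra. nra. }
    replace (2 * k)%nat with (2 * m + 2 * (k - m))%nat by lia. rewrite pow_add.
    apply Rle_trans with (exp (a * (1 - theta) * L) *
      (w n i * (1 - (1 - theta) * l n i) ^ (2 * m) * exp (- (a * (1 - theta) * L)))).
    + apply Rmult_le_compat_l; [left; apply exp_pos|].
      rewrite Rminus_0_r, <- Rmult_assoc.
      apply Rmult_le_compat_l; [apply Rmult_le_pos; assumption|exact Hdec].
    + rewrite exp_Ropp. right. field. apply Rgt_not_eq, exp_pos.
Qed.

Lemma lazy_cutoff_at theta (S : nat -> nat) : 1 / 2 <= theta < 1 ->
  spectrally_negligible (fun n => INR (S n)) -> cv_infty (fun n => INR (S n)) ->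
  eventually (fun n => lazy_energy theta n (S n) <= 1 /\
                       forall m, (m < S n)%nat -> 1 < lazy_energy theta n m) ->
  forall a, 0 < a < 1 ->
    (forall e, 0 < e ->
       eventually (fun n => lazy_energy theta n (nat_ceil ((1 + a) * INR (S n))) <= e)) /\
    (forall M, eventually (fun n => M <= lazy_energy theta n (nat_floor ((1 - a) * INR (S n))))).
Proof.
  intros Hth Hneg Hinf HS a Ha. rewrite cv_infty_eventually in Hinf. split.
  - intros e He.
    destruct (exp_decay_small (2 * a * (1 - theta)) (e / 2)) as [L [HL HLe]]; [nra|lra|].
    refine (eventually_imp _ _ _ (eventually_and _ _ HS (eventually_and _ _ (Hinf 1)
      (Hneg L (e / 2) HL _)))); [|lra].
    intros n [[H1 _] [Hpos H2]].
    pose proof (nat_ceil_spec ((1 + a) * INR (S n)) ltac:(nra)) as [Hc _].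
    pose proof (lazy_energy_after theta n (S n) a L _ Hth ltac:(lra) (proj1 Ha) HL Hc).
    pose proof (exp_pos (- (2 * a * (1 - theta) * L))).
    pose proof (lazy_energy_nonneg theta n (S n)). nra.
  - intros M. destruct (exp_decay_unbounded (a * (1 - theta)) (2 * Rabs M)) as [L [HL HLM]];
      [nra|].
    (* a S >= 2 gives (1 - a) S + a S/2 <= S - 1, the gap needed up to the last time [S n - 1] at
       which the energy exceeds 1. *)
    refine (eventually_imp _ _ _ (eventually_and _ _ HS (eventually_and _ _ (Hinf (2 / a))
      (Hneg L (1 / 2) HL _)))); [|lra].
    intros n [[_ H1] [Hbig H2]].
    assert (Ha2 : 2 <= a * INR (S n)).
    { apply (Rmult_le_compat_l a) in Hbig; [|lra].
      replace (a * (2 / a)) with 2 in Hbig by (field; lra). exact Hbig. }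
    assert (HS1 : (1 <= S n)%nat) by (apply INR_le; simpl; nra).
    specialize (H1 (S n - 1)%nat ltac:(lia)).
    pose proof (nat_floor_spec ((1 - a) * INR (S n)) ltac:(nra)) as [Hf _].
    pose proof (lazy_energy_before theta n (INR (S n)) a L (nat_floor ((1 - a) * INR (S n)))
      (S n - 1)%nat Hth ltac:(nra) Ha HL) as Hb.
    rewrite minus_INR in Hb by exact HS1. simpl INR in Hb.
    specialize (Hb ltac:(nra)).
    pose proof (Rle_abs M). pose proof (exp_pos (a * (1 - theta) * L)). nra.
Qed.

(** Beyond the low mass, which is at most E/2, the energy decays exponentially, so a long enough
    wait brings the rest below E/2. This supplies the witness for [T2_cont_spec]. *)
Lemma cont_energy_hits_below n L t E : 0 < t -> 0 < L -> 0 < E -> low_mass n (L / t) <= E / 2 ->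
  exists s, 0 <= s /\ cont_energy n s <= E.
Proof.
  intros Ht HL HE Hlow.
  set (c := cont_energy n t). pose proof (cont_energy_nonneg n t : 0 <= c).
  destruct (exp_decay_small (2 * L) (E / (2 * (c + 1)))) as [a [Ha HaE]];
    [lra|apply Rdiv_lt_0_compat; lra|].
  exists ((1 + a) * t). split; [nra|].
  pose proof (cont_energy_after n t a L Ht Ha HL) as H1.
  replace (2 * a * L) with (2 * L * a) in H1 by ring. fold c in H1.
  assert (exp (- (2 * L * a)) * c <= E / (2 * (c + 1)) * (c + 1)).
  { pose proof (exp_pos (- (2 * L * a))). apply Rmult_le_compat; lra. }
  replace (E / (2 * (c + 1)) * (c + 1)) with (E / 2) in * by (field; lra). lra.
Qed.

(** * Mixing times and cutoff in terms of energies *)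

Context (dc : nat -> R -> R).
Context (Hdc : forall n t, 0 <= t -> dc n t = sqrt (cont_energy n t)).

Lemma T2_cont_spec n eps t0 : 0 < eps -> 0 <= t0 -> cont_energy n t0 <= eps * eps ->
  let T := T2_cont (dc n) eps in
  0 <= T /\ cont_energy n T <= eps * eps /\
  forall s, 0 <= s -> cont_energy n s <= eps * eps -> T <= s.
Proof.
  intros He Ht0 Hle T.
  assert (Hiff : forall s, 0 <= s -> (dc n s <= eps <-> cont_energy n s <= eps * eps)).
  { intros s Hs. rewrite Hdc by exact Hs. apply sqrt_le_iff; [apply cont_energy_nonneg|exact He]. }
  assert (HT : 0 <= T /\ dc n T <= eps /\ forall s, 0 <= s -> dc n s <= eps -> T <= s).
  { unfold T, T2_cont. apply epsilon_spec.
    (* The infimum of the admissible times is obtained as the supremum [tau] of their lower bounds;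
       it remains to see that it is attained. *)
    set (E := fun x => forall s, 0 <= s -> cont_energy n s <= eps * eps -> x <= s).
    destruct (completeness E) as [tau [Hub Hlub]].
    - exists t0. intros x Hx. apply Hx; assumption.
    - exists 0. intros s Hs _. exact Hs.
    - assert (Htau : 0 <= tau) by (apply Hub; intros s Hs _; exact Hs).
      exists tau. split; [exact Htau|]. split.
      + apply Hiff; [exact Htau|]. apply Rnot_lt_le. intros Hgt.
        (* Otherwise the energy exceeds eps^2 up to [tau + h], which is then a lower bound too. *)
        set (h := (cont_energy n tau - eps * eps) / (8 * (cont_energy n tau))).
        assert (Hc : 0 < cont_energy n tau) by nra.
        assert (Hh : 0 < h) by (apply Rdiv_lt_0_compat; lra).
        assert (Hnear : forall s, tau <= s <= tau + h -> eps * eps < cont_energy n s).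
        { intros s Hs. pose proof (cont_energy_log_lipschitz n tau (s - tau) ltac:(lra)) as H1.
          replace (tau + (s - tau)) with s in H1 by ring.
          assert (H2 : (1 - 4 * h) * exp (4 * (s - tau)) <= 1).
          { pose proof (exp_ineq1_le (- (4 * h))).
            apply Rle_trans with (exp (- (4 * h)) * exp (4 * (s - tau))).
            - apply Rmult_le_compat_r; [left; apply exp_pos|lra].
            - rewrite <- exp_plus, <- exp_0. apply exp_le. lra. }
          (* With this [h], (1 - 4h) times the energy at [tau] is the midpoint between that energy
             and eps^2. *)
          assert (H3 : 8 * h * cont_energy n tau = cont_energy n tau - eps * eps).
          { unfold h. field. lra. }
          assert (H4 : h <= 1 / 8).
          { apply (Rmult_le_reg_r (8 * cont_energy n tau)); [lra|]. nra. }
          pose proof (cont_energy_nonneg n s).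
          assert ((1 - 4 * h) * cont_energy n tau <= cont_energy n s).
          { apply Rle_trans with ((1 - 4 * h) * (exp (4 * (s - tau)) * cont_energy n s)).
            - apply Rmult_le_compat_l; lra.
            - rewrite <- Rmult_assoc. rewrite <- (Rmult_1_l (cont_energy n s)) at 2.
              apply Rmult_le_compat_r; assumption. }
          nra. }
        assert (Hbad : E (tau + h)).
        { intros s Hs HsE. apply Rnot_lt_le. intros Hlt.
          destruct (Rle_dec tau s).
          - specialize (Hnear s ltac:(lra)). lra.
          - pose proof (cont_energy_mono n s tau ltac:(lra)). lra. }
        specialize (Hub _ Hbad). lra.
      + intros s Hs Hds. apply Hlub. intros x Hx. apply Hx; [exact Hs|].
        apply Hiff; assumption. }
  destruct HT as [HT0 [HT1 HT2]]. split; [exact HT0|]. split.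
  - apply Hiff; assumption.
  - intros s Hs HsE. apply HT2; [exact Hs|]. apply Hiff; assumption.
Qed.

Section Lazy.
Context (theta : R) (Hth : 1 / 2 <= theta < 1) (dl : nat -> nat -> R).
Context (Hdl : forall n m, dl n m = sqrt (lazy_energy theta n m)).

Lemma T2_lazy_spec n eps m0 : 0 < eps -> lazy_energy theta n m0 <= eps * eps ->
  let T := T2_disc (dl n) eps in
  lazy_energy theta n T <= eps * eps /\
  forall m, lazy_energy theta n m <= eps * eps -> (T <= m)%nat.
Proof.
  intros He Hm0 T.
  assert (Hiff : forall m, dl n m <= eps <-> lazy_energy theta n m <= eps * eps).
  { intros m. rewrite Hdl. apply sqrt_le_iff; [apply lazy_energy_nonneg|exact He]. }
  destruct (T2_disc_spec (dl n) eps m0) as [H1 H2]; [apply Hiff, Hm0|].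
  split; [apply Hiff, H1|]. intros m Hm. apply H2, Hiff, Hm.
Qed.

Definition cont_cutoff_times (t : nat -> R) : Prop :=
  (forall n, 0 < t n) /\ forall a, 0 < a < 1 ->
    (forall e, 0 < e -> eventually (fun n => cont_energy n ((1 + a) * t n) <= e)) /\
    (forall M, eventually (fun n => M <= cont_energy n ((1 - a) * t n))).

Definition lazy_cutoff_times (t : nat -> R) : Prop :=
  (forall n, 0 < t n) /\ forall a, 0 < a < 1 ->
    (forall e, 0 < e ->
       eventually (fun n => lazy_energy theta n (nat_ceil ((1 + a) * t n)) <= e)) /\
    (forall M, eventually (fun n => M <= lazy_energy theta n (nat_floor ((1 - a) * t n)))).

Lemma cutoff_cont_energy : cutoff_cont dc <-> exists t, cont_cutoff_times t.
Proof.
  assert (Hext : forall t, (forall n, 0 <= t n) ->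
    (Un_cv (fun n => dc n (t n)) 0 <->
       forall e, 0 < e -> eventually (fun n => cont_energy n (t n) <= e))
    /\ (cv_infty (fun n => dc n (t n)) <-> forall M, eventually (fun n => M <= cont_energy n (t n)))).
  { intros t Ht.
    replace (fun n => dc n (t n)) with (fun n => sqrt (cont_energy n (t n)))
      by (apply functional_extensionality; intros n; symmetry; apply Hdc, Ht).
    split; [apply sqrt_cv_0|apply sqrt_cv_infty]; intros; apply cont_energy_nonneg. }
  assert (Hnn : forall (t : nat -> R) a, (forall n, 0 < t n) -> 0 < a < 1 ->
    (forall n, 0 <= (1 + a) * t n) /\ (forall n, 0 <= (1 - a) * t n)).
  { intros t a Hpos Ha. split; intros n; specialize (Hpos n); apply Rmult_le_pos; lra. }
  split; intros [t [Hpos Ht]]; exists t; (split; [exact Hpos|]); intros a Ha;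
    destruct (Ht a Ha) as [H1 H2]; destruct (Hnn t a Hpos Ha) as [P1 P2];
    destruct (Hext _ P1) as [V _]; destruct (Hext _ P2) as [_ D];
    (split; [apply V|apply D]; assumption).
Qed.

Lemma cutoff_disc_energy : cutoff_disc dl <-> exists t, lazy_cutoff_times t.
Proof.
  assert (Hext : forall m : nat -> nat,
    (Un_cv (fun n => dl n (m n)) 0 <->
       forall e, 0 < e -> eventually (fun n => lazy_energy theta n (m n) <= e))
    /\ (cv_infty (fun n => dl n (m n)) <->
       forall M, eventually (fun n => M <= lazy_energy theta n (m n)))).
  { intros m.
    replace (fun n => dl n (m n)) with (fun n => sqrt (lazy_energy theta n (m n)))
      by (apply functional_extensionality; intros n; symmetry; apply Hdl).
    split; [apply sqrt_cv_0|apply sqrt_cv_infty]; intros; apply lazy_energy_nonneg. }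
  split; intros [t [Hpos Ht]]; exists t; (split; [exact Hpos|]); intros a Ha;
    destruct (Ht a Ha) as [H1 H2];
    destruct (Hext (fun n => nat_ceil ((1 + a) * t n))) as [V _];
    destruct (Hext (fun n => nat_floor ((1 - a) * t n))) as [_ D];
    (split; [apply V|apply D]; assumption).
Qed.

Let Tc eps n := T2_cont (dc n) eps.
Let Tl eps n := T2_disc (dl n) eps.

(** Cutoff with a = 1/2 traps the mixing times of every level between t/2 and 3t/2, so all levels
    are comparable. The discrete analogue loses 1 on each side by rounding. *)
Lemma cont_mixing_time_bounds t eps : cont_cutoff_times t -> 0 < eps ->
  eventually (fun n =>
    (cont_energy n (Tc eps n) <= eps * eps /\
     forall s, 0 <= s -> cont_energy n s <= eps * eps -> Tc eps n <= s) /\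
    t n / 2 <= Tc eps n <= 3 / 2 * t n).
Proof.
  intros [Hpos Ht] He. destruct (Ht (1 / 2) ltac:(lra)) as [H1 H2].
  refine (eventually_imp _ _ _ (eventually_and _ _ (H1 (eps * eps) _) (H2 (eps * eps + 1))));
    [|nra].
  intros n [Hle Hge]. specialize (Hpos n).
  destruct (T2_cont_spec n eps ((1 + 1 / 2) * t n) He ltac:(lra) Hle) as [HT0 [HT1 HT2]].
  split; [split; assumption|]. split.
  - apply Rnot_lt_le. intros Hlt.
    pose proof (cont_energy_mono n (Tc eps n) ((1 - 1 / 2) * t n) ltac:(lra)).
    unfold Tc in *. lra.
  - specialize (HT2 ((1 + 1 / 2) * t n) ltac:(lra) Hle). unfold Tc. lra.
Qed.

Lemma lazy_mixing_time_bounds t eps : lazy_cutoff_times t -> 0 < eps ->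
  eventually (fun n =>
    (lazy_energy theta n (Tl eps n) <= eps * eps /\
     forall m, lazy_energy theta n m <= eps * eps -> (Tl eps n <= m)%nat) /\
    t n / 2 - 1 <= INR (Tl eps n) <= 3 / 2 * t n + 1).
Proof.
  intros [Hpos Ht] He. destruct (Ht (1 / 2) ltac:(lra)) as [H1 H2].
  refine (eventually_imp _ _ _ (eventually_and _ _ (H1 (eps * eps) _) (H2 (eps * eps + 1))));
    [|nra].
  intros n [Hle Hge]. specialize (Hpos n).
  destruct (T2_lazy_spec n eps _ He Hle) as [HT1 HT2].
  split; [split; assumption|]. split.
  - pose proof (nat_floor_spec ((1 - 1 / 2) * t n) ltac:(lra)).
    enough (nat_floor ((1 - 1 / 2) * t n) <= Tl eps n)%nat as Hfl.
    { apply le_INR in Hfl. lra. }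
    apply Nat.nlt_ge. intros Hlt.
    pose proof (lazy_energy_mono theta n (Tl eps n) _ Hth (Nat.lt_le_incl _ _ Hlt)).
    unfold Tl in *. lra.
  - pose proof (nat_ceil_spec ((1 + 1 / 2) * t n) ltac:(lra)).
    pose proof (le_INR _ _ (HT2 _ Hle)). unfold Tl. lra.
Qed.

(** * Transfer of cutoff between the two families *)

(** Of the two energy comparisons this direction takes only G(m) <= F((1 - theta) m), which is valid
    at theta = 1/2 too. It keeps the continuous mixing time at level 1 of order at least t, so
    negligibility passes to it. *)
Lemma cont_cutoff_of_lazy : cutoff_disc dl ->
  (exists eps0, 0 < eps0 /\ cv_infty (fun n => INR (T2_disc (dl n) eps0))) ->
  cutoff_cont dc.
Proof.
  intros Hcut [eps0 [He0 Hinf]]. apply cutoff_disc_energy in Hcut as [t Ht].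
  assert (Htinf : cv_infty t).
  { apply (cv_infty_transfer _ _ (3 / 2) 1 ltac:(lra) Hinf).
    refine (eventually_imp _ _ _ (lazy_mixing_time_bounds t eps0 Ht He0)).
    intros n [_ [_ H]]. exact H. }
  destruct Ht as [Hpos Ht]. destruct (Ht (1 / 2) ltac:(lra)) as [Hsmall Hlarge].
  pose proof (lazy_decay_negligible theta t Hth Htinf Hsmall) as Hneg.
  rewrite cv_infty_eventually in Htinf.
  (* Cutoff times must be positive for every [n]; the default 1 can occur for finitely many [n]
     only. *)
  set (r := fun n => if Rlt_dec 0 (Tc 1 n) then Tc 1 n else 1).
  assert (Hr : eventually (fun n => (0 < r n /\ cont_energy n (r n) <= 1 /\
      forall s, 0 <= s < r n -> 1 < cont_energy n s) /\ (1 - theta) / 4 * t n <= r n)).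
  { refine (eventually_imp _ _ _ (eventually_and _ _ (Hneg 1 (1 / 2) _ _)
      (eventually_and _ _ (Hlarge 2) (Htinf 4)))); [|lra|lra].
    intros n [Hlow [Hge Ht4]].
    destruct (cont_energy_hits_below n 1 (t n) (1 * 1) (Hpos n) ltac:(lra) ltac:(lra))
      as [s [Hs HsE]]; [lra|].
    destruct (T2_cont_spec n 1 s ltac:(lra) Hs HsE) as [HT0 [HT1 HT2]].
    fold (Tc 1 n) in HT0, HT1, HT2.
    (* For t >= 4 the floor of t/2 is at least t/4, and the lazy energy there is still at least
       2. *)
    assert (Hbig : (1 - theta) / 4 * t n <= Tc 1 n).
    { apply Rnot_lt_le. intros Hlt.
      pose proof (nat_floor_spec ((1 - 1 / 2) * t n) ltac:(lra)) as Hfl.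
      pose proof (lazy_energy_le_cont theta n (nat_floor ((1 - 1 / 2) * t n)) Hth).
      pose proof (cont_energy_mono n (Tc 1 n)
        ((1 - theta) * INR (nat_floor ((1 - 1 / 2) * t n))) ltac:(nra)).
      lra. }
    assert (0 < Tc 1 n) by (pose proof (Rmult_lt_0_compat ((1 - theta) / 4) (t n)); lra).
    unfold r. destruct (Rlt_dec 0 (Tc 1 n)) as [_|]; [|lra].
    split; [|exact Hbig]. split; [assumption|]. split; [lra|].
    intros s' Hs'. apply Rnot_le_lt. intros Hle.
    specialize (HT2 s' (proj1 Hs') ltac:(lra)). lra. }
  apply cutoff_cont_energy. exists r. split.
  { intros n. unfold r. destruct (Rlt_dec 0 (Tc 1 n)); lra. }
  apply cont_cutoff_at.
  - apply (spectrally_negligible_slower t r ((1 - theta) / 4)); [lra|exact Hneg| |].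
    + exists 0%nat. intros. apply Hpos.
    + refine (eventually_imp _ _ _ Hr). tauto.
  - refine (eventually_imp _ _ _ Hr). tauto.
Qed.

Section StrictlyLazy.
Context (Hth' : 1 / 2 < theta).

Let c := - ln (2 * theta - 1) / 2.

Lemma log_rate_pos : 0 < c.
Proof.
  assert (ln (2 * theta - 1) < ln 1) by (apply ln_increasing; lra).
  rewrite ln_1 in *. unfold c. lra.
Qed.

(** F(c m) <= G(m) bounds the lazy mixing time at level 1 below by t/(2c), which transfers
    negligibility; the other comparison makes that time finite. Divergence of the times makes
    rounding harmless. *)
Lemma lazy_cutoff_of_cont : cutoff_cont dc ->
  (exists eps0, 0 < eps0 /\ cv_infty (fun n => T2_cont (dc n) eps0)) ->
  cutoff_disc dl.
Proof.
  intros Hcut [eps0 [He0 Hinf]]. apply cutoff_cont_energy in Hcut as [t Ht].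
  pose proof log_rate_pos as Hc.
  assert (Htinf : cv_infty t).
  { apply (cv_infty_transfer _ _ (3 / 2) 0 ltac:(lra) Hinf).
    refine (eventually_imp _ _ _ (cont_mixing_time_bounds t eps0 Ht He0)).
    intros n [_ [_ H]]. unfold Tc in H. lra. }
  destruct Ht as [Hpos Ht]. destruct (Ht (1 / 2) ltac:(lra)) as [Hsmall Hlarge].
  pose proof (cont_decay_negligible t Hpos Hsmall) as Hneg.
  assert (HS : eventually (fun n => (lazy_energy theta n (Tl 1 n) <= 1 /\
      forall m, (m < Tl 1 n)%nat -> 1 < lazy_energy theta n m) /\
      / (2 * c) * t n <= INR (Tl 1 n))).
  { refine (eventually_imp _ _ _ (eventually_and _ _ (Hsmall 1 _) (Hlarge 2))); [|lra].
    intros n [Hle Hge]. specialize (Hpos n).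
    (* Chosen so that (1 - theta) m0 >= 3t/2, where the continuous energy is already at most 1. *)
    set (m0 := nat_ceil ((1 + 1 / 2) * t n / (1 - theta))).
    assert (Hm0 : lazy_energy theta n m0 <= 1 * 1).
    { apply Rle_trans with (1 := lazy_energy_le_cont theta n m0 Hth).
      rewrite Rmult_1_r. apply Rle_trans with (2 := Hle). apply cont_energy_mono.
      assert (Hx : 0 <= (1 + 1 / 2) * t n / (1 - theta)).
      { apply Rmult_le_pos; [lra|]. left. apply Rinv_0_lt_compat. lra. }
      destruct (nat_ceil_spec _ Hx) as [Hm _]. fold m0 in Hm.
      apply (Rmult_le_compat_l (1 - theta)) in Hm; [|lra].
      replace ((1 - theta) * ((1 + 1 / 2) * t n / (1 - theta)))
        with ((1 + 1 / 2) * t n) in Hm by (field; lra). exact Hm. }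
    destruct (T2_lazy_spec n 1 m0 ltac:(lra) Hm0) as [HT1 HT2].
    fold (Tl 1 n) in HT1, HT2. split; [split; [lra|]|].
    - intros m Hm. apply Rnot_le_lt. intros HmE.
      specialize (HT2 m ltac:(lra)). lia.
    - apply Rnot_lt_le. intros Hlt.
      apply (Rmult_lt_compat_l (2 * c)) in Hlt; [|lra].
      replace (2 * c * (/ (2 * c) * t n)) with (t n) in Hlt by (field; lra).
      pose proof (cont_energy_le_lazy theta n (Tl 1 n) (conj Hth' (proj2 Hth))) as H1.
      fold c in H1.
      pose proof (cont_energy_mono n (c * INR (Tl 1 n)) ((1 - 1 / 2) * t n) ltac:(lra)). lra. }
  assert (HSinf : cv_infty (fun n => INR (Tl 1 n))).
  { apply (cv_infty_transfer t _ (2 * c) 0 ltac:(lra) Htinf).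
    refine (eventually_imp _ _ _ HS). intros n [_ H].
    apply (Rmult_le_compat_l (2 * c)) in H; [|lra].
    replace (2 * c * (/ (2 * c) * t n)) with (t n) in H by (field; lra). lra. }
  assert (Hik : 0 < / (2 * c)) by (apply Rinv_0_lt_compat; lra).
  (* The maximum only secures positivity for every [n]; eventually it is [Tl 1 n]. *)
  set (S := fun n => max 1 (Tl 1 n)).
  assert (HSE : eventually (fun n => S n = Tl 1 n)).
  { pose proof (proj1 (cv_infty_eventually _) HSinf 1) as H1.
    refine (eventually_imp _ _ _ H1). intros n Hn. unfold S.
    apply Nat.max_r, INR_le, Hn. }
  apply cutoff_disc_energy. exists (fun n => INR (S n)). split.
  { intros n. apply lt_0_INR. unfold S. lia. }
  apply lazy_cutoff_at.
  - exact Hth.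
  - apply (spectrally_negligible_slower t _ (/ (2 * c)) Hik Hneg).
    + exists 0%nat. intros. apply Hpos.
    + refine (eventually_imp _ _ _ (eventually_and _ _ HS HSE)).
      intros n [[_ H] E]. rewrite E. exact H.
  - apply (cv_infty_transfer _ _ 1 0 ltac:(lra) HSinf). exists 0%nat. intros n _.
    assert (INR (Tl 1 n) <= INR (S n)) by (apply le_INR; unfold S; lia). lra.
  - refine (eventually_imp _ _ _ (eventually_and _ _ HS HSE)).
    intros n [[H _] E]. rewrite E. exact H.
Qed.

(** * Comparison of mixing times *)

Lemma lazy_mixing_time_infty : cutoff_cont dc -> cutoff_disc dl ->
  (exists eps0, 0 < eps0 /\
     (cv_infty (fun n => T2_cont (dc n) eps0) \/ cv_infty (fun n => INR (T2_disc (dl n) eps0)))) ->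
  forall eps, 0 < eps -> cv_infty (fun n => INR (T2_disc (dl n) eps)).
Proof.
  intros Hc Hd [eps0 [He0 Hinf]] eps He.
  apply cutoff_cont_energy in Hc as [tc Htc]. apply cutoff_disc_energy in Hd as [td Htd].
  pose proof log_rate_pos as Hcpos.
  destruct Hinf as [Hinf|Hinf].
  (* Tc(eps0) <= 3/2 tc <= 3 Tc(eps) <= 3c Tl(eps). *)
  - apply (cv_infty_transfer _ _ (3 * c) 0 ltac:(lra) Hinf).
    refine (eventually_imp _ _ _ (eventually_and _ _ (cont_mixing_time_bounds tc eps0 Htc He0)
      (eventually_and _ _ (cont_mixing_time_bounds tc eps Htc He)
        (lazy_mixing_time_bounds td eps Htd He)))).
    intros n [[_ [_ H1]] [[[_ Hmin] [H2 _]] [[HE _] _]]].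
    pose proof (cont_energy_le_lazy theta n (Tl eps n) (conj Hth' (proj2 Hth))) as Hcl.
    fold c in Hcl. pose proof (pos_INR (Tl eps n)).
    specialize (Hmin (c * INR (Tl eps n)) ltac:(apply Rmult_le_pos; lra) ltac:(lra)).
    unfold Tc, Tl in *. lra.
  (* Tl(eps0) <= 3/2 td + 1 and td <= 2 Tl(eps) + 2. *)
  - apply (cv_infty_transfer _ _ 3 4 ltac:(lra) Hinf).
    refine (eventually_imp _ _ _ (eventually_and _ _ (lazy_mixing_time_bounds td eps0 Htd He0)
      (lazy_mixing_time_bounds td eps Htd He))).
    intros n [[_ [_ H1]] [_ [H2 _]]]. unfold Tl in *. lra.
Qed.

(** The energy comparisons give Tc <= c Tl directly and Tl <= ceil(Tc/(1 - theta)); rounding costs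
    at most 1 - theta in Tc, which vanishes after division by Tl since Tl diverges. *)
Lemma mixing_time_comparison : cutoff_cont dc -> cutoff_disc dl ->
  (exists eps0, 0 < eps0 /\
     (cv_infty (fun n => T2_cont (dc n) eps0) \/ cv_infty (fun n => INR (T2_disc (dl n) eps0)))) ->
  forall eps, 0 < eps ->
    (forall delta, 0 < delta -> eventually (fun n =>
       1 - theta - delta <= T2_cont (dc n) eps / INR (T2_disc (dl n) eps))) /\
    (forall delta, 0 < delta -> eventually (fun n =>
       T2_cont (dc n) eps / INR (T2_disc (dl n) eps) <= - ln (2 * theta - 1) / 2 + delta)).
Proof.
  intros Hc Hd Hinf0 eps He.
  pose proof (lazy_mixing_time_infty Hc Hd Hinf0 eps He) as Hinf.
  rewrite cv_infty_eventually in Hinf.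
  apply cutoff_cont_energy in Hc as [tc Htc]. apply cutoff_disc_energy in Hd as [td Htd].
  pose proof log_rate_pos as Hcpos.
  assert (Hboth := eventually_and _ _ (cont_mixing_time_bounds tc eps Htc He)
    (lazy_mixing_time_bounds td eps Htd He)).
  assert (Hpos := proj1 Htc).
  split; intros delta Hdelta.
  - refine (eventually_imp _ _ _ (eventually_and _ _ Hboth
      (* Tl >= 1 permits the division, and Tl >= 1/delta makes delta Tl exceed the rounding
         error. *)
      (eventually_and _ _ (Hinf 1) (Hinf (1 / delta))))).
    intros n [[[[HE _] [HTpos _]] [[_ Hmin] _]] [H1 Hbig]]. specialize (Hpos n).
    fold (Tl eps n) in H1, Hbig |- *. fold (Tc eps n).
    set (m := nat_ceil (Tc eps n / (1 - theta))).
    assert (Hx : 0 <= Tc eps n / (1 - theta)).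
    { apply Rmult_le_pos; [lra|]. left. apply Rinv_0_lt_compat. lra. }
    destruct (nat_ceil_spec _ Hx) as [Hm1 Hm2]. fold m in Hm1, Hm2.
    assert (EQ : (1 - theta) * (Tc eps n / (1 - theta)) = Tc eps n) by (field; lra).
    apply (Rmult_le_compat_l (1 - theta)) in Hm1; [|lra].
    apply (Rmult_lt_compat_l (1 - theta)) in Hm2; [|lra].
    assert (HTm : (Tl eps n <= m)%nat).
    { apply Hmin. apply Rle_trans with (1 := lazy_energy_le_cont theta n m Hth).
      apply Rle_trans with (2 := HE). apply cont_energy_mono. lra. }
    apply le_INR in HTm.
    apply (Rmult_le_compat_l delta) in Hbig; [|lra].
    replace (delta * (1 / delta)) with 1 in Hbig by (field; lra).
    apply (Rmult_le_reg_r (INR (Tl eps n))); [lra|].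
    replace (Tc eps n / INR (Tl eps n) * INR (Tl eps n)) with (Tc eps n) by (field; lra).
    apply (Rmult_le_compat_l (1 - theta)) in HTm; [|lra]. lra.
  - refine (eventually_imp _ _ _ (eventually_and _ _ Hboth (Hinf 1))).
    intros n [[[[_ Hmin] _] [[HE _] _]] H1].
    fold (Tl eps n) in H1 |- *. fold (Tc eps n). fold c.
    pose proof (cont_energy_le_lazy theta n (Tl eps n) (conj Hth' (proj2 Hth))) as Hcl.
    fold c in Hcl.
    specialize (Hmin (c * INR (Tl eps n)) ltac:(apply Rmult_le_pos; lra) ltac:(lra)).
    apply (Rmult_le_reg_r (INR (Tl eps n))); [lra|].
    replace (Tc eps n / INR (Tl eps n) * INR (Tl eps n)) with (Tc eps n) by (field; lra).
    assert (0 <= delta * INR (Tl eps n)) by (apply Rmult_le_pos; lra). lra.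
Qed.
End StrictlyLazy.
End Lazy.
End Decay.

Theorem theorem3p5
  (N : nat -> nat) (K : nat -> nat -> nat -> R) (pi mu : nat -> nat -> R)
  (Hchain : forall n, is_chain (N n) (K n) (pi n))
  (Hirr : forall n, irreducible (N n) (K n))
  (Hrev : forall n, reversible (N n) (K n) (pi n))
  (Hmu : forall n, is_prob (N n) (mu n))
  (Hchi : cv_infty (fun n => chi2 (N n) (pi n) (mu n))) :
  let dc := fun n t => d2_cont (N n) (K n) (pi n) (mu n) t in
  let dl := fun theta n m => d2_disc (N n) (lazyK theta (K n)) (pi n) (mu n) m in
  let Tc := fun n eps => T2_cont (dc n) eps in
  let Tl := fun theta n eps => T2_disc (dl theta n) eps in
  (* (1) *)
  (forall theta, 1/2 <= theta < 1 ->
     cutoff_disc (dl theta) ->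
     (exists eps0, 0 < eps0 /\ cv_infty (fun n => INR (Tl theta n eps0))) ->
     cutoff_cont dc) /\
  (* (2) *)
  (cutoff_cont dc ->
     (exists eps0, 0 < eps0 /\ cv_infty (fun n => Tc n eps0)) ->
     forall theta, 1/2 < theta < 1 -> cutoff_disc (dl theta)) /\
  (* comparison of mixing times *)
  (forall theta, 1/2 < theta < 1 ->
     cutoff_cont dc -> cutoff_disc (dl theta) ->
     (exists eps0, 0 < eps0 /\
        (cv_infty (fun n => Tc n eps0) \/ cv_infty (fun n => INR (Tl theta n eps0)))) ->
     forall eps, 0 < eps ->
       (* 1 - theta <= liminf_n Tc/Tl *)
       (forall delta, 0 < delta -> exists n0, forall n, (n0 <= n)%nat ->
          1 - theta - delta <= Tc n eps / INR (Tl theta n eps)) /\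
       (* limsup_n Tc/Tl <= -log(2 theta - 1)/2 *)
       (forall delta, 0 < delta -> exists n0, forall n, (n0 <= n)%nat ->
          Tc n eps / INR (Tl theta n eps) <= - ln (2 * theta - 1) / 2 + delta)).
Proof.
  (* Weights and eigenvalues are paired so that a single use of choice yields both for all [n]. *)
  assert (Hspec : forall n, exists p : (nat -> R) * (nat -> R),
    (forall i, (i < N n)%nat -> 0 <= fst p i) /\ (forall i, (i < N n)%nat -> 0 <= snd p i <= 2) /\
    (forall t, 0 <= t -> d2_cont (N n) (K n) (pi n) (mu n) t =
       sqrt (fsum (N n) (fun i => fst p i * exp (- (2 * t * snd p i))))) /\
    (forall theta m, d2_disc (N n) (lazyK theta (K n)) (pi n) (mu n) m =
       sqrt (fsum (N n) (fun i => fst p i * (1 - (1 - theta) * snd p i) ^ (2 * m))))).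
  { intros n.
    destruct (spectral_representation _ _ _ _ (Hchain n) (Hrev n) (Hmu n)) as [w [l H]].
    exists (w, l). exact H. }
  destruct (choice _ Hspec) as [p Hp].
  set (w := fun n => fst (p n)). set (l := fun n => snd (p n)).
  assert (Hw : forall n i, (i < N n)%nat -> 0 <= w n i) by (intro n; apply (Hp n)).
  assert (Hl : forall n i, (i < N n)%nat -> 0 <= l n i <= 2) by (intro n; apply (Hp n)).
  intros dc dl Tc Tl.
  assert (Hdc : forall n t, 0 <= t -> dc n t = sqrt (cont_energy N w l n t))
    by (intro n; apply (Hp n)).
  assert (Hdl : forall theta n m, dl theta n m = sqrt (lazy_energy N w l theta n m))
    by (intros theta n m; apply (Hp n)).
  split; [|split].
  - intros theta Hth.
    exact (cont_cutoff_of_lazy N w l Hw Hl dc Hdc theta Hth (dl theta) (Hdl theta)).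
  - intros Hcut Hinf theta Hth.
    exact (lazy_cutoff_of_cont N w l Hw Hl dc Hdc theta ltac:(lra) (dl theta) (Hdl theta)
      (proj1 Hth) Hcut Hinf).
  - intros theta Hth.
    exact (mixing_time_comparison N w l Hw Hl dc Hdc theta ltac:(lra) (dl theta) (Hdl theta)
      (proj1 Hth)).
Qed.
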